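(* Let $1<p<\infty$, $-\frac1p<\gamma<1-\frac1p$, and let $d=(d_n)_{n\ge0}$ be a strictly increasing sequence of positive integers with $d_0=1$. (i) If $\lim_{k\to\infty} d_k/d_{k-1}=1$ and $g=(g_k)_{k\ge1}$ is a complex sequence such that the limit $\lim_{n\to\infty} G(n;d;g)$ exists in $[0,\infty)$, then $$\|H_{g,\gamma}\|_{e,\ell^p\to\ell^p}=\frac{\pi}{\sin\left(\pi\left(\frac1p+\gamma\right)\right)}\left(\lim_{n\to\infty} G(n;d;g)\right)^{\frac1p}.$$ (ii) If $\lim_{k\to\infty} d_k/d_{k-1}>1$, then there exists no function $F\colon[0,\infty)^{\mathbb N}\to[0,\infty)$ such that $$\|H_{g,\gamma}\|_{e,\ell^p\to\ell^p}=F\big((G(n;d;g))_{n\in\mathbb N}\big)$$ for all complex sequences $g$ for which $H_{g,\gamma}$ is bounded on $\ell^p$.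
   Context: Here $\mathbb N=\{1,2,\dots\}$. For a sequence $g=(g_k)$ and $n\in\mathbb N$, $$G(n;d;g):=\frac1{d_n-d_{n-1}}\sum_{k=d_{n-1}}^{d_n-1}|g_k|^p .$$ The operator $H_{g,\gamma}$ maps $a=(a_n)_{n\ge1}\in\ell^p$ to the sequence whose $k$-th entry ($k\in\mathbb N$) is $$\sum_{n=1}^\infty \left(\frac kn\right)^\gamma\frac{g_k a_n}{n+k}.$$ The essential norm of a bounded operator $S\colon\ell^p\to\ell^p$ is $\|S\|_{e,\ell^p\to\ell^p}:=\inf_T\|S-T\|_{\ell^p\to\ell^p}$, the infimum being over all compact operators $T\colon\ell^p\to\ell^p$. *)

(* Defs.v *)
From HB Require Import structures.
From mathcomp Require Import all_boot all_order all_algebra.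
From mathcomp Require Import all_classical all_reals all_analysis.
From mathcomp Require Import complex.

Set Implicit Arguments.
Unset Strict Implicit.
Unset Printing Implicit Defensive.

Import Order.TTheory GRing.Theory Num.Theory.
Import numFieldNormedType.Exports.

Local Open Scope classical_set_scope.
Local Open Scope ring_scope.
Local Open Scope complex_scope.

(* Convention: a sequence (x_k) indexed by k = 1, 2, ... is represented by a
   function x on nat with x_k = x k.-1, that is, x k is the entry of index
   k.+1.  Only d = (d_n), indexed from 0 on paper as well, is not shifted. *)

Section Lp.
Context {R : realType}.
Implicit Types (p : R) (a b : nat -> R[i]).
Implicit Types S T : (nat -> R[i]) -> (nat -> R[i]).

(* The modulus with values in R; `|z| has values in R[i]. *)
Definition modulus (z : R[i]) : R := ComplexField.Normc.normc z.

(* (\sum_k |a_k|^p)^(1/p), equal to +oo outside l^p. *)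
Definition lpnorm p a : \bar R :=
  Lnorm (@counting nat R) p%:E (fun k => (modulus (a k))%:E).

Definition in_lp p a : Prop := (lpnorm p a < +oo)%E.

(* An operator on l^p is given by a function on all complex sequences, of
   which only the values on l^p matter. *)
Definition linear_on_lp p S : Prop :=
  forall (c : R[i]) a b, in_lp p a -> in_lp p b ->
    S (fun n => c * a n + b n) = (fun n => c * S a n + S b n).

Definition bounded_op p S : Prop :=
  linear_on_lp p S /\
  exists M : R, forall a, in_lp p a -> (lpnorm p (S a) <= M%:E * lpnorm p a)%E.

(* Every norm-bounded sequence (x j) of l^p has a subsequence whose image
   converges in l^p. *)
Definition compact_op p T : Prop :=
  [/\ linear_on_lp p T,
      (forall a, in_lp p a -> in_lp p (T a)) &
      forall (x : nat -> (nat -> R[i])) (M : R),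
        (forall j, (lpnorm p (x j) <= M%:E)%E) ->
        exists (phi : nat -> nat) (b : nat -> R[i]),
          [/\ {homo phi : i j / (i < j)%N},
              in_lp p b &
              lpnorm p (T (x (phi j)) \- b) @[j --> \oo] --> 0%E]].

Definition opnorm p S : \bar R :=
  ereal_sup [set lpnorm p (S a) | a in [set a | (lpnorm p a <= 1)%E]].

Definition essnorm p S : \bar R :=
  ereal_inf [set opnorm p (fun a => S a \- T a) | T in compact_op p].

(* H_{g,gamma}.  The sum is a limit in R[i]; it converges absolutely when a is
   in l^p and -1/p < gamma < 1 - 1/p, by Hoelder's inequality. *)
Definition hilbert_op (g : nat -> R[i]) (gamma : R) (a : nat -> R[i]) :
    nat -> R[i] :=
  fun k => limn (series (fun n =>
    ((k.+1%:R / n.+1%:R) `^ gamma)%:C * (g k * a n / (n.+1 + k.+1)%:R))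
    : nat -> (R[i] : numFieldType)).

(* Entry n is G(n+1; d; g). *)
Definition block_mean p (d : nat -> nat) (g : nat -> R[i]) : nat -> R :=
  fun n => ((d n.+1)%:R - (d n)%:R)^-1 *
           \sum_(d n <= k < d n.+1) modulus (g k.-1) `^ p.

End Lp.

(* Main.v *)
Require Import Defs.
From HB Require Import structures.
From mathcomp Require Import all_boot all_order all_algebra.
From mathcomp Require Import all_classical all_reals all_analysis.
From mathcomp Require Import complex.
From mathcomp Require Import ring lra.

Set Implicit Arguments.
Unset Strict Implicit.
Unset Printing Implicit Defensive.

Import Order.TTheory GRing.Theory Num.Theory.
Import numFieldNormedType.Exports.

Local Open Scope classical_set_scope.
Local Open Scope ring_scope.
Local Open Scope complex_scope.

(* Put s = 1/p + gamma and C = pi / sin (pi s).  The Schur test with weights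
   n^(-1/p) bounds H = H_{1,gamma} by C, because the sums
   \sum_n (k/n)^s / (n + k) are lower Riemann sums of the decreasing function
   t^(-s) / (1 + t), whose integral over ]0, +oo[ is C.  That integral is
   avoided: alternating partial sums of the expansion of 1 / (1 + t) bound the
   Riemann sums on both sides, through the mean value theorem, by partial sums
   of the partial fraction series of pi / sin (pi s), which is obtained by
   Herglotz's trick.  On the sequences n^(-1/p) supported in long intervals far
   out, H acts almost as multiplication by C, and the l^p norm of a weighted
   image is governed by the harmonic sums of |g_k|^p / k.

   Upper bound in (i): a block [d_n, d_(n+1)[ with d_(n+1)/d_n near 1 sees H a
   as almost constant, so |g_k|^p may be replaced by its block mean there, and
   removing finitely many rows costs a compact operator.  Lower bound: a compact
   operator cannot distinguish long disjointly supported test sequences.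
   (ii): g = 1 gives an essential norm at most C; a sequence with the same block
   means but concentrated on the first half of each block has larger harmonic
   sums when the blocks are long, hence an essential norm greater than C. *)

(** * Partial fractions of pi / sin (pi x) *)

Section Cosecant.
Context {R : realType}.
Implicit Types x y t : R.

(** The constant C must be sharp from both sides, so row sums of the kernel need an upper bound
    valid for every row and a lower bound uniform in the row. Scale invariance gives the uniformity:
    row k is sampled at t = n/k with mesh 1/k, hence only the ratios of the ends of the range of n
    to k matter. Both lower bounds use one density hypothesis on |g_k|^p / k over intervals [A, B[.
    The intervals must lie far out so that the test sequences can avoid any given finite set of
    coordinates. They must be long because the two ends of the support cost a bounded amount, which
    only a divergent harmonic sum absorbs. The density parameter is near the limit of the block
    means in (i) and greater than 1 in (ii). Estimates are made on finite sums of nonnegative reals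
    and raised to the power p, so that rows can be regrouped into blocks or split into head and tail
    by plain addition. Complex sequences and limits enter only when these estimates are carried over
    to the operator. *)

Lemma sin_le_id y : 0 <= y -> sin y <= y.
Proof.
rewrite le_eqVlt => /predU1P[<-|y0]; first by rewrite sin0.
have [c _] : exists2 c, c \in `]0, y[ & y - sin y - (0 - sin 0) = (1 - cos c) * (y - 0).
  apply: (@MVT R (fun t => t - sin t) (fun t => 1 - cos t)) => //.
  apply: continuous_subspaceT => t.
  by apply: cvgB; [exact: cvg_id|exact: continuous_sin].
rewrite sin0 !subr0 => e; rewrite -subr_ge0 e mulr_ge0 ?subr_ge0 ?cos_le1 ?(ltW y0)//.
Qed.

Lemma mul_cos_le_sin y : 0 <= y <= pi -> y * cos y <= sin y.
Proof.
move=> /andP[]; rewrite le_eqVlt => /predU1P[<-|y0] ypi; first by rewrite sin0 mul0r.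
have [c cy] : exists2 c, c \in `]0, y[ &
    (sin y - y * cos y) - (sin 0 - 0 * cos 0) = (c * sin c) * (y - 0).
  apply: (@MVT R (fun t => sin t - t * cos t) (fun t => t * sin t)) => //.
    move=> t _; apply: is_derive_eq.
    by rewrite /GRing.scale /=; ring.
  apply: continuous_subspaceT => t.
  apply: cvgB; first exact: continuous_sin.
  by apply: cvgM; [exact: cvg_id|exact: continuous_cos].
move: cy; rewrite in_itv /= => /andP[c0 cy].
rewrite sin0 mul0r !subr0 => e; rewrite -subr_ge0 e !mulr_ge0 ?ltW//.
by rewrite sin_gt0_pi// c0 (lt_le_trans cy).
Qed.

Definition cot_pi x := pi * cos (pi * x) / sin (pi * x).

(** The poles are paired as -n and n + 1, not as -n and n. With this pairing every finite sum is odd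
    about x = 1/2, and the duplication formula takes N to exactly 2N without a boundary term. *)
Definition cot_partial (N : nat) x :=
  \sum_(0 <= n < N) ((n%:R + x)^-1 - (n.+1%:R - x)^-1).

Definition csc_partial (N : nat) x :=
  \sum_(0 <= m < N) (-1) ^+ m * ((m%:R + x)^-1 + (m.+1%:R - x)^-1).

Lemma sin_pi_gt0 x : 0 < x < 1 -> 0 < sin (pi * x).
Proof.
move=> /andP[x0 x1]; rewrite sin_gt0_pi// mulr_gt0 ?pi_gt0//=.
by rewrite -[ltRHS]mulr1 ltr_pM2l ?pi_gt0.
Qed.

(** The inverse square of the sine is 1 plus the square of the cotangent, and the cotangent is at
    most 1/y by [mul_cos_le_sin]. *)
Lemma inv_sin_sqr_le y : 0 < y <= pi / 2 -> 0 <= (sin y) ^- 2 - y ^- 2 <= 1.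
Proof.
move=> /andP[y0 yp].
have p0 := @pi_gt0 R.
have s0 : 0 < sin y by rewrite sin_gt0_pi// y0 (le_lt_trans yp)//; lra.
have sy := sin_le_id (ltW y0).
have c0 : 0 <= cos y by rewrite cos_ge0_pihalf// yp andbT; lra.
have cs : y * cos y <= sin y by rewrite mul_cos_le_sin// (ltW y0) (le_trans yp)//; lra.
rewrite subr_ge0 lef_pV2 ?posrE ?exprn_gt0// ler_sqr ?nnegrE ?(ltW s0) ?(ltW y0)// sy /=.
rewrite lerBlDr -[(sin y) ^- 2]mul1r ler_pdivrMr ?exprn_gt0//.
have -> : 1 = cos y ^+ 2 + sin y ^+ 2 by rewrite cos2Dsin2.
have -> : (cos y ^+ 2 + sin y ^+ 2 + y ^- 2) * sin y ^+ 2 =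
   sin y ^+ 2 + y ^- 2 * sin y ^+ 2.
  by rewrite cos2Dsin2; ring.
rewrite addrC lerD2l mulrC ler_pdivlMr ?exprn_gt0//.
by rewrite -exprMn mulrC ler_sqr ?nnegrE// ?mulr_ge0// ltW.
Qed.

(** This is the derivative of [cot_pi - cot_partial 1]. It is invariant under the reflection of x to
    1 - x, so x may be taken at most 1/2; there the pole at 0 cancels up to pi^2 by
    [inv_sin_sqr_le], and the other pole contributes at most 4. *)
Lemma cot_remainder_bound x : 0 < x < 1 ->
  `|- (pi ^+ 2 / sin (pi * x) ^+ 2) + x ^- 2 + (1 - x) ^- 2| <= pi ^+ 2 + 4.
Proof.
have p0 := @pi_gt0 R.
wlog x2 : x / x <= 1 / 2.
  move=> H /andP[x0 x1]; have [|/ltW h] := lerP x (1 / 2).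
    by move=> xh; apply: H => //; rewrite x0.
  have /= := H (1 - x); rewrite mulrBr mulr1 sinB sinpi cospi mul0r sub0r mulN1r opprK.
  rewrite subKr addrAC; apply; first lra.
  by apply/andP; split; lra.
move=> /andP[x0 x1].
have /inv_sin_sqr_le /andP[h1 h2] : 0 < pi * x <= pi / 2.
  by rewrite mulr_gt0//= ler_pM2l// -div1r.
have -> : - (pi ^+ 2 / sin (pi * x) ^+ 2) + x ^- 2 =
   - (pi ^+ 2 * ((sin (pi * x)) ^- 2 - (pi * x) ^- 2)).
  have sx : sin (pi * x) != 0 by rewrite gt_eqF// sin_pi_gt0// x0.
  have idn (P s u : R) : P != 0 -> s != 0 -> u != 0 ->
      - (P ^+ 2 / s ^+ 2) + u ^- 2 = - (P ^+ 2 * (s ^- 2 - (P * u) ^- 2)).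
    by move=> P0 s0 u0; field; rewrite P0 s0 u0.
  by rewrite idn// gt_eqF.
have h3 : 0 <= (1 - x) ^- 2 <= 4.
  rewrite invr_ge0 sqr_ge0 /=.
  have -> : 4 = (1 / 2) ^- 2 :> R by field.
  rewrite lef_pV2 ?posrE ?exprn_gt0//; last lra.
  by rewrite ler_sqr ?nnegrE; lra.
have h4 : pi ^+ 2 * ((sin (pi * x)) ^- 2 - (pi * x) ^- 2) <= pi ^+ 2.
  by rewrite -[leRHS]mulr1 ler_pM2l ?exprn_gt0.
have h5 : 0 <= pi ^+ 2 * ((sin (pi * x)) ^- 2 - (pi * x) ^- 2) by rewrite mulr_ge0 ?sqr_ge0.
case/andP: h3 => h3 h3'.
by rewrite ler_norml; apply/andP; split; lra.
Qed.

(** Herglotz's trick in Lipschitz form: once the poles at 0 and 1 are subtracted the derivative is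
    bounded on the open interval, which replaces the continuous extension and the maximum of the
    classical argument. *)
Lemma cot_remainder_lipschitz x y : 0 < x < 1 -> 0 < y < 1 ->
  `|(cot_pi x - cot_partial 1 x) - (cot_pi y - cot_partial 1 y)|
    <= (pi ^+ 2 + 4) * `|x - y|.
Proof.
wlog xy : x y / y < x.
  move=> H hx hy; case: (ltgtP x y) => [xy|xy|<-].
  - by rewrite distrC [X in _ * X]distrC H.
  - by rewrite H.
  - by rewrite !subrr normr0 mulr0.
move=> /andP[x0 x1] /andP[y0 y1].
have E t : cot_pi t - cot_partial 1 t = pi * cos (pi * t) / sin (pi * t) - t^-1 + (1 - t)^-1.
  by rewrite /cot_partial big_nat1 add0r opprB addrA addrAC.
pose df t := - (pi ^+ 2 / sin (pi * t) ^+ 2) + t ^- 2 + (1 - t) ^- 2.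
have der t : 0 < t < 1 -> is_derive t 1
    (fun t => pi * cos (pi * t) / sin (pi * t) - t^-1 + (1 - t)^-1) (df t).
  move=> /andP[t0 t1].
  have s0 : sin (pi * t) != 0 by rewrite gt_eqF// sin_pi_gt0// t0.
  have t0' : t != 0 by rewrite gt_eqF.
  have t1' : 1 - t != 0 by rewrite subr_eq0 gt_eqF.
  have ds : is_derive t 1 (fun t => sin (pi * t)) (pi * cos (pi * t)).
    have d0 : is_derive t 1 (fun t => pi * t) (pi *: 1) by exact: is_deriveZ.
    have := @is_derive1_comp _ sin (fun t => pi * t) t _ _ (is_derive_sin _) d0.
    by move=> h; apply: (is_derive_eq h); rewrite /GRing.scale /=; ring.
  have dc : is_derive t 1 (fun t => cos (pi * t)) (- pi * sin (pi * t)).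
    have d0 : is_derive t 1 (fun t => pi * t) (pi *: 1) by exact: is_deriveZ.
    have := @is_derive1_comp _ cos (fun t => pi * t) t _ _ (is_derive_cos _) d0.
    by move=> h; apply: (is_derive_eq h); rewrite /GRing.scale /=; ring.
  have d1 : is_derive t 1 (fun t => (sin (pi * t))^-1) (- sin (pi * t) ^- 2 *: (pi * cos (pi * t))).
    exact: is_deriveV.
  have d2 : is_derive t 1 (fun t : R => t^-1) (- t ^- 2 *: 1).
    exact: (@is_deriveV R id t 1 1 t0' _).
  have d3 : is_derive t 1 (fun t : R => (1 - t)^-1) (- (1 - t) ^- 2 *: (0 - 1)).
    exact: (@is_deriveV R (fun t => 1 - t) t _ 1 t1' _).
  apply: is_derive_eq.
  rewrite /df /GRing.scale /=.
  have cs := cos2Dsin2 (pi * t).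
  have idn (P s c u w : R) : s != 0 -> u != 0 -> w != 0 ->
      P * c * (- s ^- 2 * (P * c)) + s^-1 * (P * (- P * s)) -
      - u ^- 2 * 1 + - w ^- 2 * (0 - 1) =
      - (P ^+ 2 * (c ^+ 2 + s ^+ 2) / s ^+ 2) + u ^- 2 + w ^- 2.
    by move=> s1 u1 w1; field; rewrite s1 u1 w1.
  apply: (etrans (idn _ _ _ _ _ s0 t0' t1')); by rewrite cs mulr1.
have sub01 t : y <= t <= x -> 0 < t < 1.
  by move=> /andP[yt tx]; rewrite (lt_le_trans y0 yt) (le_lt_trans tx x1).
pose f t := pi * cos (pi * t) / sin (pi * t) - t^-1 + (1 - t)^-1.
have fder t : y <= t <= x -> is_derive t 1 f (df t) by move=> /sub01; exact: der.
have [c cy] : exists2 c, c \in `]y, x[ & f x - f y = df c * (x - y).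
  apply: MVT; first exact: xy.
    by move=> t; rewrite in_itv /= => /andP[yt tx]; apply: fder; rewrite !ltW.
  apply: derivable_within_continuous => t; rewrite in_itv /= => ytx.
  exact: (@ex_derive _ _ _ _ _ _ _ (fder t ytx)).
rewrite !E -/(f x) -/(f y).
move: cy; rewrite in_itv /= => /andP[yc cx] ->.
rewrite normrM ler_wpM2r// /df cot_remainder_bound//.
by rewrite (lt_trans y0)// (lt_trans cx).
Qed.

(** The second argument is shifted by a quarter period, which turns the cotangent into minus the
    tangent. The sum drives the recursion on the cotangent; the difference converts its expansion
    into that of the cosecant. *)
Lemma cot_pi_double x : 0 < x < 1 ->
  cot_pi (x / 2) + cot_pi ((x + 1) / 2) = 2 * cot_pi x /\
  cot_pi (x / 2) - cot_pi ((x + 1) / 2) = 2 * (pi / sin (pi * x)).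
Proof.
move=> hx; have sx := sin_pi_gt0 hx; case/andP: hx => x0 x1.
have e : pi * x = (pi * (x / 2)) *+ 2 by rewrite -mulr_natr; field.
have e2 : pi * ((x + 1) / 2) = pi * (x / 2) + pi / 2 :> R by field.
rewrite /cot_pi e2 cosDpihalf sinDpihalf.
rewrite e in sx *.
move: sx; rewrite sin_mulr2n cos_mulr2n -!(mulr_natr (cos _ * _)).
set c := cos _; set s := sin _ => cs0.
have cs : c ^+ 2 + s ^+ 2 = 1 by rewrite cos2Dsin2.
have c0 : c != 0 by apply: contraTneq cs0 => ->; rewrite !mul0r ltxx.
have s0 : s != 0 by apply: contraTneq cs0 => ->; rewrite mulr0 mul0r ltxx.
have id1 (P a b : R) : a != 0 -> b != 0 ->
    P * a / b - P * - b / a = 2 * (P * (a ^+ 2 + b ^+ 2) / (a * b * 2)).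
  by move=> a0 b0; field; rewrite a0 b0.
have id2 (P a b : R) : a != 0 -> b != 0 ->
    P * a / b + P * - b / a = 2 * (P * (a ^+ 2 - b ^+ 2) / (a * b * 2)).
  by move=> a0 b0; field; rewrite a0 b0.
split; last by rewrite id1// cs mulr1.
have s2 : s ^+ 2 = 1 - c ^+ 2 by rewrite -cs addrAC subrr add0r.
have -> : c * c * 2 - 1 = c ^+ 2 - s ^+ 2 by rewrite s2; ring.
exact: id2.
Qed.

Lemma big_nat_double (f : nat -> R) N :
  \sum_(0 <= m < N.*2) f m = \sum_(0 <= n < N) (f n.*2 + f n.*2.+1).
Proof.
elim: N => [|N IH]; first by rewrite !big_geq.
by rewrite doubleS !big_nat_recr//= IH addrA.
Qed.

Lemma natS (n : nat) : n.+1%:R = n%:R + 1 :> R. Proof. by rewrite -addn1 natrD. Qed.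

Lemma cot_partial_double N x : 0 < x < 1 ->
  cot_partial N (x / 2) + cot_partial N ((x + 1) / 2) = 2 * cot_partial N.*2 x /\
  cot_partial N (x / 2) - cot_partial N ((x + 1) / 2) = 2 * csc_partial N.*2 x.
Proof.
move=> /andP[x0 x1]; rewrite /cot_partial /csc_partial !big_nat_double !mulr_sumr.
split; rewrite -?sumrB -?big_split /=; apply: eq_bigr => n _;
  have n0 : (0 : R) <= n%:R by []; rewrite ?exprS -?mul2n ?exprM ?sqrrN ?expr1n !natS !natrM;
  field; do ?(apply/andP; split); lra.
Qed.

(* Both halves of the duplication formula contract, so the Lipschitz constant
   of the remainder of the cotangent series is halved when N is doubled. *)
Lemma cot_remainder_lipschitz_pow j x y : 0 < x < 1 -> 0 < y < 1 ->
  `|(cot_pi x - cot_partial (2 ^ j) x) - (cot_pi y - cot_partial (2 ^ j) y)|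
    <= (pi ^+ 2 + 4) / 2 ^+ j * `|x - y|.
Proof.
elim: j x y => [|j IH] x y hx hy; first by rewrite divr1 cot_remainder_lipschitz.
have E z : 0 < z < 1 -> cot_pi z - cot_partial (2 ^ j.+1) z =
  ((cot_pi (z / 2) - cot_partial (2 ^ j) (z / 2)) +
   (cot_pi ((z + 1) / 2) - cot_partial (2 ^ j) ((z + 1) / 2))) / 2.
  move=> hz; have [c _] := cot_pi_double hz; have [d _] := cot_partial_double (2 ^ j) hz.
  rewrite addrACA -opprD c d -mul2n -expnS; by field.
rewrite !E// -mulrBl opprD addrACA normrM [X in _ * X]ger0_norm//.
rewrite ler_pdivrMr//.
case/andP: hx => x0 x1; case/andP: hy => y0 y1.
have := IH (x / 2) (y / 2); have := IH ((x + 1) / 2) ((y + 1) / 2).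
have -> : (x + 1) / 2 - (y + 1) / 2 = (x - y) / 2 by field.
rewrite -mulrBl normrM [X in _ * (_ * X)]ger0_norm// => h1 h2.
apply: (le_trans (ler_normD _ _)).
have -> : (pi ^+ 2 + 4) / 2 ^+ j.+1 * `|x - y| * 2 =
  (pi ^+ 2 + 4) / 2 ^+ j * (`|x - y| / 2) + (pi ^+ 2 + 4) / 2 ^+ j * (`|x - y| / 2) :> R.
  have u0 : 2 ^+ j != 0 :> R by rewrite expf_neq0.
  rewrite [2 ^+ j.+1]exprS; move: (2 ^+ j) (pi ^+ 2 + 4) u0 => u L u0; by field.
apply: lerD; [apply: h2|apply: h1]; apply/andP; split; lra.
Qed.

(** Both functions vanish at 1/2, so the Lipschitz bound against that point bounds the remainder
    itself. *)
Lemma cot_remainder_le j x : 0 < x < 1 ->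
  `|cot_pi x - cot_partial (2 ^ j) x| <= (pi ^+ 2 + 4) / 2 ^+ j.
Proof.
move=> hx; have h2 : 0 < (1 / 2 : R) < 1 by apply/andP; split; lra.
have := cot_remainder_lipschitz_pow j hx h2.
have -> : cot_pi (1 / 2) = 0 by rewrite /cot_pi div1r cos_pihalf mulr0 mul0r.
have -> : cot_partial (2 ^ j) (1 / 2) = 0.
  rewrite /cot_partial big1// => n _; rewrite (natS n).
  have -> : n%:R + 1 - 1 / 2 = n%:R + 1 / 2 :> R by field.
  by rewrite subrr.
rewrite !subr0 => h; apply: (le_trans h); rewrite ler_piMr//.
  by rewrite divr_ge0 ?exprn_ge0// addr_ge0// sqr_ge0.
by case/andP: hx => x0 x1; rewrite ler_norml; apply/andP; split; lra.
Qed.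

Lemma csc_partial_le j x : 0 < x < 1 ->
  `|pi / sin (pi * x) - csc_partial (2 ^ j.+1) x| <= (pi ^+ 2 + 4) / 2 ^+ j.
Proof.
move=> hx; have [_ c] := cot_pi_double hx; have [_ d] := cot_partial_double (2 ^ j) hx.
have -> : pi / sin (pi * x) - csc_partial (2 ^ j.+1) x =
  ((cot_pi (x / 2) - cot_partial (2 ^ j) (x / 2)) -
   (cot_pi ((x + 1) / 2) - cot_partial (2 ^ j) ((x + 1) / 2))) / 2.
  have e a b a' b' : (a - b) - (a' - b') = (a - a') - (b - b') :> R by ring.
  by rewrite e c d expnS mul2n -mulrBr [2 * _]mulrC mulfK.
rewrite normrM [X in _ * X]ger0_norm// ler_pdivrMr//.
have e (a : R) : a * 2 = a + a by ring.
apply: (le_trans (ler_normB _ _)); rewrite e.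
by case/andP: hx => x0 x1; apply: lerD; apply: cot_remainder_le; apply/andP; split; lra.
Qed.

(** An even number of terms is the truncation that serves lower bounds. Upper bounds need one term
    more, and the lower bound on J keeps that term small. *)
Lemma csc_partial_approx x e : 0 < x < 1 -> 0 < e ->
  exists J, `|pi / sin (pi * x) - csc_partial J.*2 x| < e /\ e^-1 <= J%:R.
Proof.
move=> hx e0; have p0 : 0 < pi ^+ 2 + 4 :> R by rewrite ltr_wpDl ?sqr_ge0.
pose j := (Num.truncn ((pi ^+ 2 + 5) / e)).+1.
have hj : (pi ^+ 2 + 5) / e < (2 ^ j)%:R.
  by rewrite (lt_trans (truncnS_gt _))// ltr_nat ltn_expl.
exists (2 ^ j)%N; split; last first.
  rewrite (le_trans _ (ltW hj))// -[leLHS]mul1r ler_pM2r ?invr_gt0//; lra.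
rewrite -mul2n -expnS (le_lt_trans (csc_partial_le _ hx))//.
rewrite ltr_pdivrMr ?exprn_gt0// mulrC -ltr_pdivrMr// -natrX (le_lt_trans _ hj)//.
by rewrite ler_pM2r ?invr_gt0//; lra.
Qed.

End Cosecant.

(** * Sums of the Hilbert kernel *)

Section KernelSums.
Context {R : realType}.
Implicit Types (s t u h e r : R) (F f phi : R -> R).

Lemma ler_powRl r t u : 0 <= r -> 0 <= t -> t <= u -> t `^ r <= u `^ r.
Proof.
by move=> r0 t0 tu; rewrite ge0_ler_powR// nnegrE; exact: le_trans tu.
Qed.

Lemma powR_invl r t : 0 <= t -> t^-1 `^ r = t `^ (- r).
Proof. by move=> t0; rewrite -powR_inv1// -powRrM mulN1r. Qed.

(** By the mean value theorem each increment of F is h times a value of f, hence at least h times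
    the value of phi at the right end. Continuity is asked apart from differentiability because the
    lemma is applied from i = 0, where the leading power t^(1-s) of the primitive is not
    differentiable. *)
Lemma riemann_sum_le F f phi h (i j : nat) : 0 < h -> (i <= j)%N ->
  (forall a b, i%:R * h <= a -> a < b -> {within `[a, b], continuous F}) ->
  (forall t, i%:R * h < t -> is_derive t 1 F (f t)) ->
  (forall t, i%:R * h < t -> phi t <= f t) ->
  (forall t u, 0 < t -> t <= u -> phi u <= phi t) ->
  \sum_(i <= n < j) phi (n.+1%:R * h) * h <= F (j%:R * h) - F (i%:R * h).
Proof.
move=> h0 ij Fc Fd phif phid; elim: j ij => [|j IH]; first by rewrite leqn0 => /eqP->; rewrite big_geq// subrr.
rewrite leq_eqVlt => /predU1P[<-|]; first by rewrite big_geq// subrr.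
rewrite ltnS => ij; rewrite big_nat_recr//=.
have ijh : i%:R * h <= j%:R * h by rewrite ler_pM2r// ler_nat.
have jj : j%:R * h < j.+1%:R * h by rewrite ltr_pM2r// ltr_nat.
have [c cj E] : exists2 c, c \in `](j%:R * h), (j.+1%:R * h)[ &
    F (j.+1%:R * h) - F (j%:R * h) = f c * (j.+1%:R * h - j%:R * h).
  apply: MVT => //; last exact: Fc.
  by move=> t; rewrite in_itv /= => /andP[jt _]; apply: Fd; exact: le_lt_trans jt.
move: cj; rewrite in_itv /= => /andP[jc cj].
have c0 : 0 < c by rewrite (le_lt_trans _ jc)// mulr_ge0// ltW.
have -> : F (j.+1%:R * h) - F (i%:R * h) =
  (F (j%:R * h) - F (i%:R * h)) + (F (j.+1%:R * h) - F (j%:R * h)) by ring.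
apply: lerD; first exact: IH.
rewrite E -mulrBl (natS j) addrAC subrr add0r mul1r -natS ler_pM2r//.
by rewrite (le_trans _ (phif _ _)) ?phid ?(ltW cj)// (le_lt_trans ijh jc).
Qed.

Lemma riemann_sum_ge F f phi h (i j : nat) : 0 < h -> (0 < i)%N -> (i <= j)%N ->
  (forall t, 0 < t -> is_derive t 1 F (f t)) ->
  (forall t, 0 < t -> f t <= phi t) ->
  (forall t u, 0 < t -> t <= u -> phi u <= phi t) ->
  F (j%:R * h) - F (i%:R * h) <= \sum_(i <= n < j) phi (n%:R * h) * h.
Proof.
move=> h0 i0 ij Fd phif phid; elim: j ij => [|j IH]; first by rewrite leqn0 => /eqP->; rewrite big_geq// subrr.
rewrite leq_eqVlt => /predU1P[<-|]; first by rewrite big_geq// subrr.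
rewrite ltnS => ij; rewrite big_nat_recr//=.
have ih0 : 0 < i%:R * h by rewrite mulr_gt0// ltr0n.
have ijh : i%:R * h <= j%:R * h by rewrite ler_pM2r// ler_nat.
have j0 := lt_le_trans ih0 ijh.
have jj : j%:R * h < j.+1%:R * h by rewrite ltr_pM2r// ltr_nat.
have [c cj E] : exists2 c, c \in `](j%:R * h), (j.+1%:R * h)[ &
    F (j.+1%:R * h) - F (j%:R * h) = f c * (j.+1%:R * h - j%:R * h).
  apply: MVT => //.
    by move=> t; rewrite in_itv /= => /andP[jt _]; apply: Fd; exact: lt_trans jt.
  apply: derivable_within_continuous => t; rewrite in_itv /= => /andP[jt _].
  exact: (@ex_derive _ _ _ _ _ _ _ (Fd t (lt_le_trans j0 jt))).
move: cj; rewrite in_itv /= => /andP[jc cj].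
have -> : F (j.+1%:R * h) - F (i%:R * h) =
  (F (j%:R * h) - F (i%:R * h)) + (F (j.+1%:R * h) - F (j%:R * h)) by ring.
apply: lerD; first exact: IH.
rewrite E -mulrBl (natS j) addrAC subrr add0r mul1r ler_pM2r//.
by rewrite (le_trans (phif _ (lt_trans j0 jc)))// phid// ltW.
Qed.

Lemma alternating_geometric J u :
  (1 + u) * \sum_(0 <= m < J) (-1) ^+ m * u ^+ m = 1 - (-1) ^+ J * u ^+ J.
Proof.
elim: J => [|J IH]; first by rewrite big_geq// mulr0 !expr0 mulr1 subrr.
by rewrite big_nat_recr//= mulrDr IH !exprS; ring.
Qed.

Lemma inv1D_le_odd J u : 0 < u -> (1 + u)^-1 <= \sum_(0 <= m < J.*2.+1) (-1) ^+ m * u ^+ m.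
Proof.
move=> u0; have u1 : 0 < 1 + u by rewrite addr_gt0.
rewrite -[leLHS]mulr1 mulrC ler_pdivrMr// mulrC alternating_geometric.
rewrite exprS -mul2n exprM sqrrN !expr1n mulr1 mulN1r opprK lerDl.
by rewrite exprn_ge0// ltW.
Qed.

Lemma inv1D_ge_even J u : 0 < u -> \sum_(0 <= m < J.*2) (-1) ^+ m * u ^+ m <= (1 + u)^-1.
Proof.
move=> u0; have u1 : 0 < 1 + u by rewrite addr_gt0.
rewrite -[leRHS]mulr1 mulrC ler_pdivlMr// mulrC alternating_geometric.
rewrite -mul2n exprM sqrrN !expr1n mul1r lerBlDr lerDl.
by rewrite exprn_ge0// ltW.
Qed.

Definition hilbert_profile s t := t `^ (- s) / (1 + t).

Lemma hilbert_profile_anti s t u : 0 < s -> 0 < t -> t <= u ->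
  hilbert_profile s u <= hilbert_profile s t.
Proof.
move=> s0 t0 tu; have u0 := lt_le_trans t0 tu.
rewrite /hilbert_profile !powRN -!invfM lef_pV2 ?posrE ?mulr_gt0 ?powR_gt0 ?addr_gt0//.
apply: ler_pM; rewrite ?powR_ge0 ?addr_ge0 ?(ltW t0)// ?lerD2l//.
exact: (ler_powRl (ltW s0) (ltW t0) tu).
Qed.

(* [low_prim] and [high_prim] are term-by-term primitives of the expansions of
   [hilbert_profile s] in powers of [t] and of [t^-1]; their partial sums
   alternately bound it from above and from below on all of ]0, +oo[. *)
Definition low_prim J s t :=
  \sum_(0 <= m < J) (-1) ^+ m * (t `^ (m.+1%:R - s) / (m.+1%:R - s)).

Definition high_prim J s t :=
  - \sum_(0 <= m < J) (-1) ^+ m * (t `^ (- (m%:R + s)) / (m%:R + s)).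

Definition low_deriv J s t := t `^ (- s) * \sum_(0 <= m < J) (-1) ^+ m * t ^+ m.

Definition high_deriv J s t :=
  t `^ (- s) / t * \sum_(0 <= m < J) (-1) ^+ m * t^-1 ^+ m.

Lemma is_derive_powR_div t e : 0 < t -> e != 0 ->
  is_derive t 1 (fun t => t `^ e / e) (t `^ (e - 1)).
Proof.
move=> t0 e0.
have h := @is_deriveM _ _ _ _ _ _ _ _ (is_derive1_powR e t0) (is_derive_cst e^-1 t 1).
apply: (is_derive_eq h); rewrite /GRing.scale /=; by field.
Qed.

Lemma is_derive_big_nat (g dg : nat -> R -> R) J t :
  (forall m, is_derive t 1 (g m) (dg m t)) ->
  is_derive t 1 (fun t => \sum_(0 <= m < J) g m t) (\sum_(0 <= m < J) dg m t).
Proof.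
move=> gd; elim: J => [|J IH].
  rewrite big_geq//; have -> : (fun t => \sum_(0 <= m < 0) g m t) = cst 0.
    by apply/funext => x; rewrite big_geq.
  exact: is_derive_cst.
rewrite big_nat_recr//=.
have -> : (fun t => \sum_(0 <= m < J.+1) g m t) =
    (fun t => \sum_(0 <= m < J) g m t) + g J.
  by apply/funext => x; rewrite big_nat_recr.
exact: is_deriveD.
Qed.

Lemma is_derive_low_prim J s t : s < 1 -> 0 < t ->
  is_derive t 1 (low_prim J s) (low_deriv J s t).
Proof.
move=> s1 t0; rewrite /low_deriv mulr_sumr.
apply: (is_derive_big_nat (dg := fun m t => t `^ (- s) * ((-1) ^+ m * t ^+ m))) => m.
have e0 : m.+1%:R - s != 0.
  by rewrite gt_eqF// subr_gt0 (lt_le_trans s1)// ler1n.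
have h := is_deriveZ ((-1) ^+ m) (is_derive_powR_div t0 e0).
apply: (is_derive_eq h); rewrite /GRing.scale /=.
have -> : m.+1%:R - s - 1 = m%:R + - s by rewrite natS; ring.
rewrite powRD; last by rewrite (gt_eqF t0) implybT.
by rewrite powR_mulrn ?(ltW t0)//; ring.
Qed.

Lemma is_derive_high_prim J s t : 0 < s -> 0 < t ->
  is_derive t 1 (high_prim J s) (high_deriv J s t).
Proof.
move=> s0 t0; rewrite /high_deriv.
have -> : high_prim J s = (fun t => \sum_(0 <= m < J) (-1) ^+ m *
    (t `^ (- (m%:R + s)) / - (m%:R + s))).
  by apply/funext => x; rewrite /high_prim -sumrN; apply: eq_bigr => m _; rewrite invrN !mulrN.
rewrite mulr_sumr.
apply: (is_derive_big_nat (dg := fun m t => t `^ (- s) / t * ((-1) ^+ m * t^-1 ^+ m))) => m.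
have e0 : - (m%:R + s) != 0 by rewrite oppr_eq0 gt_eqF// ltr_wpDl.
have h := is_deriveZ ((-1) ^+ m) (is_derive_powR_div t0 e0).
apply: (is_derive_eq h); rewrite /GRing.scale /=.
have -> : - (m%:R + s) - 1 = - m.+1%:R + - s by rewrite natS; ring.
rewrite powRD; last by rewrite (gt_eqF t0) implybT.
rewrite powR_invn ?(ltW t0)// exprS invfM -exprVn; ring.
Qed.

Lemma powR_within_continuous e a b : 0 < e -> 0 <= a -> a < b ->
  {within `[a, b], continuous (fun t => t `^ e)}.
Proof.
move=> e0 a0 ab.
have pc t : 0 < t -> {for t, continuous (fun t => t `^ e)}.
  move=> t0; apply: differentiable_continuous; apply/derivable1_diffP.
  by apply: derivable_powR; rewrite in_itv /= t0.
apply/continuous_within_itvP => //; split.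
- by move=> t; rewrite in_itv /= => /andP[at_ _]; apply: pc; exact: le_lt_trans at_.
- move: a0; rewrite le_eqVlt => /predU1P[<-|a0].
    by rewrite powR0 ?gt_eqF//; exact: powR_cvg0.
  by apply: cvg_at_right_filter; exact: pc.
- by apply: cvg_at_left_filter; apply: pc; exact: le_lt_trans ab.
Qed.

Lemma low_prim_within_continuous J s a b : s < 1 -> 0 <= a -> a < b ->
  {within `[a, b], continuous (low_prim J s)}.
Proof.
move=> s1 a0 ab; rewrite /low_prim; elim: J => [|J IH].
  have -> : (fun t => \sum_(0 <= m < 0)
      (-1) ^+ m * (t `^ (m.+1%:R - s) / (m.+1%:R - s))) = cst 0.
    by apply/funext => x; rewrite big_geq.
  by move=> x; exact: cvg_cst.
have -> : (fun t => \sum_(0 <= m < J.+1)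
      (-1) ^+ m * (t `^ (m.+1%:R - s) / (m.+1%:R - s))) =
   (fun t => \sum_(0 <= m < J) (-1) ^+ m * (t `^ (m.+1%:R - s) / (m.+1%:R - s)) +
     (-1) ^+ J * (t `^ (J.+1%:R - s) / (J.+1%:R - s))).
  by apply/funext => x; rewrite big_nat_recr.
have e0 : 0 < J.+1%:R - s by rewrite subr_gt0 (lt_le_trans s1)// ler1n.
move=> x; apply: cvgD; first exact: IH.
apply: cvgMr; apply: cvgMl; exact: (powR_within_continuous e0 a0 ab).
Qed.

(** This is where the partial fractions appear: the expansion in t is used up to t = 1, the one in
    1/t beyond, and the m-th terms of the two primitives at 1 combine into the m-th term of the
    cosecant series. *)
Lemma low_prim1_sub_high_prim1 J s :
  low_prim J s 1 - high_prim J s 1 = csc_partial J s.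
Proof.
rewrite /low_prim /high_prim /csc_partial opprK -big_split /=.
by apply: eq_bigr => m _; rewrite !powR1 !mul1r -mulrDr addrC.
Qed.

Lemma low_prim0 J s : s < 1 -> low_prim J s 0 = 0.
Proof.
move=> s1; rewrite /low_prim big1// => m _.
by rewrite powR0 ?mul0r ?mulr0// gt_eqF// subr_gt0 (lt_le_trans s1)// ler1n.
Qed.

(** For t at least 1 the terms decrease with m, so an alternating sum of an odd number of them has
    the sign of its first term. The value at the far end can then be dropped from the upper
    bound. *)
Lemma high_prim_odd_le0 J s t : 0 < s -> 1 <= t -> high_prim J.*2.+1 s t <= 0.
Proof.
move=> s0 t1; rewrite /high_prim oppr_le0 big_nat_recr//= big_nat_double.
have t0 : 0 < t by exact: lt_le_trans t1.
apply: addr_ge0; last first.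
  by rewrite -mul2n exprM sqrrN !expr1n mul1r divr_ge0 ?powR_ge0// addr_ge0// ltW.
apply: sumr_ge0 => n _; rewrite exprS -mul2n exprM sqrrN !expr1n mulr1 !mul1r mulN1r subr_ge0.
apply: ler_pM; rewrite ?powR_ge0 ?invr_ge0 ?addr_ge0 ?(ltW s0)//.
  by rewrite ler_powR// lerN2 lerD2r ler_nat.
by rewrite lef_pV2 ?posrE ?ltr_wpDl// lerD2r ler_nat.
Qed.

Definition hilbert_kernel s (k n : nat) : R := (k%:R / n%:R) `^ s / (n + k)%:R.

Lemma hilbert_kernel_ge0 s k n : 0 <= hilbert_kernel s k n.
Proof. by rewrite divr_ge0 ?powR_ge0. Qed.

Lemma hilbert_kernelE s k n : (0 < k)%N -> (0 < n)%N ->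
  hilbert_kernel s k n = hilbert_profile s (n%:R * k%:R^-1) * k%:R^-1.
Proof.
move=> k0 n0; rewrite /hilbert_kernel /hilbert_profile powRN.
have k0' : k%:R != 0 :> R by rewrite pnatr_eq0 -lt0n.
have n0' : n%:R != 0 :> R by rewrite pnatr_eq0 -lt0n.
have -> : (n%:R / k%:R) `^ s = ((k%:R / n%:R) `^ s)^-1 :> R.
  by rewrite -powRN -[in RHS]invf_div powR_invl ?divr_ge0// opprK.
rewrite invrK natrD -!mulrA; congr (_ * _).
by field; rewrite k0' paddr_eq0// negb_and k0' n0'.
Qed.

Lemma hilbert_kernel_sum_le s (k N : nat) : 0 < s < 1 -> (0 < k)%N ->
  \sum_(0 <= n < N) hilbert_kernel s k n.+1 <= pi / sin (pi * s).
Proof.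
move=> hs k0; have /andP[s0 s1] := hs.
have k0' : 0 < k%:R^-1 :> R by rewrite invr_gt0 ltr0n.
(* Enlarging the range puts the splitting point n = k, that is t = 1, inside it for every N. *)
apply: (@le_trans _ _ (\sum_(0 <= n < k + N) hilbert_kernel s k n.+1)).
  rewrite [leRHS](@big_cat_nat _ _ _ N) ?leq_addl//= lerDl.
  by rewrite sumr_ge0// => *; exact: hilbert_kernel_ge0.
apply/ler_addgt0Pr => e e0.
(* One third of e pays for the even truncation, the other two for the two reciprocals in the extra
   term of the odd one. *)
have [J [h1 h2]] := csc_partial_approx hs (divr_gt0 e0 (ltr0Sn _ 2)).
apply: (@le_trans _ _ (csc_partial J.*2.+1 s)); last first.
  have J0 : 0 < J%:R :> R by rewrite (lt_le_trans _ h2)// invr_gt0 divr_gt0.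
  have J1 : J%:R^-1 <= e / 3 by rewrite -[leRHS]invrK lef_pV2 ?posrE ?invr_gt0 ?divr_gt0.
  have JJ : J%:R <= J.*2%:R :> R by rewrite ler_nat -addnn leq_addr.
  rewrite /csc_partial big_nat_recr//= -/(csc_partial _ _) -mul2n exprM sqrrN !expr1n mul1r mul2n.
  have : (J.*2%:R + s)^-1 <= J%:R^-1.
    by rewrite lef_pV2 ?posrE ?ltr_wpDl// (le_trans JJ)// lerDl ltW.
  have : (J.*2.+1%:R - s)^-1 <= J%:R^-1.
    have JJ2 : J%:R <= J.*2.+1%:R - s.
      by rewrite natS lerBrDr; apply: lerD => //; exact: ltW.
    by rewrite lef_pV2 ?posrE// (lt_le_trans J0 JJ2).
  move: h1; rewrite ltr_norml => /andP[h3 h4]; lra.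
rewrite (@big_cat_nat _ _ _ k)//= ?leq_addr//.
under eq_bigr do rewrite hilbert_kernelE//.
under [X in _ + X]eq_bigr do rewrite hilbert_kernelE//.
have kk : k%:R * k%:R^-1 = 1 :> R by rewrite mulfV// pnatr_eq0 -lt0n.
have A := @riemann_sum_le (low_prim J.*2.+1 s) (low_deriv J.*2.+1 s)
  (hilbert_profile s) _ _ _ k0' (leq0n k).
have B := @riemann_sum_le (high_prim J.*2.+1 s) (high_deriv J.*2.+1 s)
  (hilbert_profile s) _ _ _ k0' (leq_addr N k).
have tp (t : R) : 1 < t -> 0 < t by apply: lt_trans.
move: A B; rewrite !kk mul0r low_prim0// subr0 => A B.
rewrite -low_prim1_sub_high_prim1; apply: lerD.
  apply: A => //.
  - by move=> a b a0 ab; exact: low_prim_within_continuous.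
  - by move=> t t0; exact: is_derive_low_prim.
  - move=> t t0; rewrite ler_pM2l ?powR_gt0//; exact: inv1D_le_odd.
  - by move=> t u t0 tu; exact: hilbert_profile_anti.
apply: le_trans (B _ _ _ _) _.
- move=> a b a1 ab; apply: derivable_within_continuous => t; rewrite in_itv /= => /andP[at_ _].
  have t0 : 0 < t by rewrite (lt_le_trans _ at_)// (lt_le_trans _ a1).
  exact: (@ex_derive _ _ _ _ _ _ _ (is_derive_high_prim J.*2.+1 s0 t0)).
- by move=> t /tp t0; exact: is_derive_high_prim.
- move=> t /tp t0; rewrite /hilbert_profile /high_deriv -mulrA ler_pM2l ?powR_gt0//.
  have -> : (1 + t)^-1 = t^-1 * (1 + t^-1)^-1.
    by rewrite -invfM mulrDr mulr1 mulfV ?gt_eqF// addrC.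
  by rewrite ler_pM2l ?invr_gt0// inv1D_le_odd// invr_gt0.
- by move=> t u t0 tu; exact: hilbert_profile_anti.
by rewrite gerDr high_prim_odd_le0// ler_pdivlMr ?ltr0n// mul1r ler_nat leq_addr.
Qed.

Lemma powR_small c a e : 0 < a -> 0 < e ->
  exists r0 : nat, (0 < r0)%N /\ forall t : R, r0%:R <= t -> c * t `^ (- a) <= e.
Proof.
move=> a0 e0; pose x := (`|c| / e + 1) `^ a^-1.
have x1 : 0 < `|c| / e + 1 by rewrite ltr_wpDl// divr_ge0// ltW.
exists (Num.truncn x).+1; split => // t rt.
have xt : x <= t by rewrite (le_trans _ rt)// ltW// truncnS_gt.
have x0 : 0 < x by rewrite powR_gt0.
have t0 : 0 < t by exact: lt_le_trans xt.
have : x `^ a <= t `^ a by exact: ler_powRl (ltW a0) (ltW x0) xt.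
rewrite /x -powRrM mulVf ?gt_eqF// powRr1 ?(ltW x1)// => h.
rewrite powRN ler_pdivrMr ?powR_gt0//.
apply: (le_trans (ler_norm c)); rewrite mulrC -ler_pdivrMr//.
by apply: le_trans h; rewrite lerDl.
Qed.

(** Every power occurring is at most t^(1-s) for t up to 1. For fixed J the primitive therefore
    tends to 0 with t, which is the cost of cutting off small n; [high_prim_le] is its counterpart
    for large n. *)
Lemma low_prim_le J s t : s < 1 -> 0 < t <= 1 ->
  `|low_prim J s t| <= J%:R * (1 - s)^-1 * t `^ (1 - s).
Proof.
move=> s1 /andP[t0 t1]; rewrite /low_prim big_mkord.
apply: (le_trans (ler_norm_sum _ _ _)).
apply: (@le_trans _ _ (\sum_(m < J) (1 - s)^-1 * t `^ (1 - s))); last first.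
  by rewrite sumr_const card_ord -[leLHS]mulr_natl mulrA.
apply: ler_sum => m _; rewrite normrM normrX normrN1 expr1n mul1r normrM.
have e0 : 0 < 1 - s by rewrite subr_gt0.
have e1 : 1 - s <= m.+1%:R - s by rewrite lerD2r ler1n.
rewrite ger0_norm ?powR_ge0// ger0_norm ?invr_ge0 ?(le_trans (ltW e0))// mulrC.
apply: ler_pM; rewrite ?powR_ge0 ?invr_ge0 ?(le_trans (ltW e0))//.
  by rewrite lef_pV2 ?posrE// (lt_le_trans e0).
by rewrite ger_powR// t0.
Qed.

Lemma high_prim_le J s t : 0 < s -> 1 <= t ->
  `|high_prim J s t| <= J%:R * s^-1 * t `^ (- s).
Proof.
move=> s0 t1; rewrite /high_prim normrN big_mkord.
apply: (le_trans (ler_norm_sum _ _ _)).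
apply: (@le_trans _ _ (\sum_(m < J) s^-1 * t `^ (- s))); last first.
  by rewrite sumr_const card_ord -[leLHS]mulr_natl mulrA.
apply: ler_sum => m _; rewrite normrM normrX normrN1 expr1n mul1r normrM.
have e1 : s <= m%:R + s by rewrite lerDr.
rewrite ger0_norm ?powR_ge0// ger0_norm ?invr_ge0 ?(le_trans (ltW s0))// mulrC.
apply: ler_pM; rewrite ?powR_ge0 ?invr_ge0 ?(le_trans (ltW s0))//.
  by rewrite lef_pV2 ?posrE// (lt_le_trans s0).
by rewrite ler_powR// lerN2.
Qed.

(** For any c < C, almost the whole mass of row k lies at n between k/r and kr, with r independent
    of k. *)
Lemma hilbert_kernel_sum_ge s c : 0 < s < 1 -> c < pi / sin (pi * s) ->
  exists r : nat, (0 < r)%N /\ forall k N M : nat, (0 < N)%N ->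
    (N * r <= k)%N -> (k * r <= M)%N ->
    c <= \sum_(N <= n < M) hilbert_kernel s k n.
Proof.
move=> hs cC; have /andP[s0 s1] := hs.
set C := pi / sin (pi * s) in cC.
(* The three losses are the truncation of the series, the lower end N/k and the upper end M/k. *)
pose e := (C - c) / 3; have e0 : 0 < e by rewrite divr_gt0 ?subr_gt0.
have [J [h1 _]] := csc_partial_approx hs e0; rewrite -/C in h1.
have s1' : 0 < 1 - s by rewrite subr_gt0.
have [r1 [r1p hr1]] := powR_small (J.*2%:R * (1 - s)^-1) s1' e0.
have [r2 [r2p hr2]] := powR_small (J.*2%:R * s^-1) s0 e0.
exists (maxn r1 r2); split; first by rewrite leq_max r1p.
move=> k N M N0 Nk kM.
have r0 : (0 < maxn r1 r2)%N by rewrite leq_max r1p.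
have k0 : (0 < k)%N by rewrite (leq_trans _ Nk)// muln_gt0 N0.
have Nk' : (N <= k)%N by rewrite (leq_trans _ Nk)// leq_pmulr.
have kM' : (k <= M)%N by rewrite (leq_trans _ kM)// leq_pmulr.
have k0' : 0 < k%:R^-1 :> R by rewrite invr_gt0 ltr0n.
have kk : k%:R * k%:R^-1 = 1 :> R by rewrite mulfV// pnatr_eq0 -lt0n.
rewrite (@big_cat_nat _ _ _ k)//=.
rewrite (@eq_big_nat _ _ _ N k _ (fun n => hilbert_profile s (n%:R * k%:R^-1) * k%:R^-1)); last first.
  by move=> n /andP[Nn _]; rewrite hilbert_kernelE// (leq_trans N0).
rewrite (@eq_big_nat _ _ _ k M _ (fun n => hilbert_profile s (n%:R * k%:R^-1) * k%:R^-1)); last first.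
  by move=> n /andP[Nn _]; rewrite hilbert_kernelE// (leq_trans k0).
have anti t u : 0 < t -> t <= u -> hilbert_profile s u <= hilbert_profile s t.
  by move=> t0 tu; exact: hilbert_profile_anti.
have A : low_prim J.*2 s 1 - low_prim J.*2 s (N%:R * k%:R^-1) <=
    \sum_(N <= n < k) hilbert_profile s (n%:R * k%:R^-1) * k%:R^-1.
  rewrite -[X in low_prim _ _ X - _]kk.
  apply: (riemann_sum_ge (f := low_deriv J.*2 s)) => //.
    by move=> t t0; exact: is_derive_low_prim.
  by move=> t t0; rewrite ler_pM2l ?powR_gt0// inv1D_ge_even.
have B : high_prim J.*2 s (M%:R * k%:R^-1) - high_prim J.*2 s 1 <=
    \sum_(k <= n < M) hilbert_profile s (n%:R * k%:R^-1) * k%:R^-1.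
  rewrite -[X in _ - high_prim _ _ X]kk.
  apply: (riemann_sum_ge (f := high_deriv J.*2 s)) => //.
    by move=> t t0; exact: is_derive_high_prim.
  move=> t t0; rewrite /hilbert_profile /high_deriv -mulrA ler_pM2l ?powR_gt0//.
  have -> : (1 + t)^-1 = t^-1 * (1 + t^-1)^-1.
    by rewrite -invfM mulrDr mulr1 mulfV ?gt_eqF// addrC.
  by rewrite ler_pM2l ?invr_gt0// inv1D_ge_even// invr_gt0.
have rk (a b r : nat) : (0 < a)%N -> (a * r <= b)%N -> r%:R <= b%:R * a%:R^-1 :> R.
  by move=> a0 ab; rewrite ler_pdivlMr ?ltr0n// -natrM ler_nat mulnC.
have N1 : r1%:R <= k%:R * N%:R^-1 :> R.
  by apply: rk => //; rewrite (leq_trans _ Nk)// leq_mul2l leq_maxl orbT.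
have M1 : r2%:R <= M%:R * k%:R^-1 :> R.
  by apply: rk => //; rewrite (leq_trans _ kM)// leq_mul2l leq_maxr orbT.
have D : `|low_prim J.*2 s (N%:R * k%:R^-1)| <= e.
  have tp : 0 < (N%:R / k%:R : R) <= 1.
    by rewrite divr_gt0 ?ltr0n// ler_pdivrMr ?ltr0n// mul1r ler_nat.
  apply: (le_trans (low_prim_le _ s1 tp)); apply: le_trans (hr1 _ N1).
  have p : 0 <= k%:R / N%:R :> R by rewrite divr_ge0.
  by rewrite -powR_invl// invf_div.
have E : `|high_prim J.*2 s (M%:R * k%:R^-1)| <= e.
  have tp : 1 <= M%:R / k%:R :> R by rewrite ler_pdivlMr ?ltr0n// mul1r ler_nat.
  exact: (le_trans (high_prim_le _ s0 tp) (hr2 _ M1)).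
have := low_prim1_sub_high_prim1 J.*2 s.
move: h1 D E; rewrite ltr_norml !ler_norml => /andP[h3 h4] /andP[d1 d2] /andP[d3 d4] E.
have : c = C - e - e - e by rewrite /e; field.
lra.
Qed.

End KernelSums.

(** * The Schur test and harmonic sums *)

Section Schur.
Context {R : realType}.
Implicit Types (p s gamma t u : R) (b w X : nat -> R).

(** Hoelder's inequality for weights of total mass at most C, obtained by summing Young's
    inequality; C is allowed to exceed the mass because only this bound is known for kernel rows. *)
Lemma power_mean_le p (C : R) N (lam t : nat -> R) : 1 < p -> 0 < C ->
  (forall n, 0 <= lam n) -> (forall n, 0 <= t n) ->
  \sum_(0 <= n < N) lam n <= C ->
  (\sum_(0 <= n < N) lam n * t n) `^ p <=
    C `^ (p - 1) * \sum_(0 <= n < N) lam n * t n `^ p.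
Proof.
move=> p1 C0 lam0 t0 lamC; set X := \sum_(0 <= n < N) lam n * t n.
have p0 : 0 < p by exact: lt_trans p1.
have X0 : 0 <= X by apply: sumr_ge0 => n _; exact: mulr_ge0.
pose q := p / (p - 1).
have pm : 0 < p - 1 by rewrite subr_gt0.
have q0 : 0 < q by rewrite divr_gt0.
have pq : p^-1 + q^-1 = 1 by rewrite /q invf_div; field; rewrite gt_eqF.
(* With this factor, X z equals C (X/C)^p, so the second Young term is 1/q of the left side and can
   be absorbed, leaving 1/p on both sides. *)
pose z := (X / C) `^ (p - 1).
have zq : z `^ q = (X / C) `^ p.
  by rewrite /z -powRrM; congr (_ `^ _); rewrite /q mulrCA mulfV ?mulr1// gt_eqF.
have XC0 : 0 <= X / C by rewrite divr_ge0// ltW.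
have zX : z * X = C * (X / C) `^ p.
  rewrite -(mulr_powRB1 XC0 p0) -/z; field; by rewrite gt_eqF.
have H : z * X <= (\sum_(0 <= n < N) lam n * t n `^ p) / p + C * (X / C) `^ p / q.
  apply: (@le_trans _ _ (\sum_(0 <= n < N) lam n * (t n `^ p / p + (X / C) `^ p / q))).
    rewrite mulr_sumr; apply: ler_sum => n _; rewrite mulrCA ler_wpM2l// mulrC -zq.
    by apply: conjugate_powR => //; exact: powR_ge0.
  under eq_bigr do rewrite mulrDr mulrA.
  rewrite big_split /= -!mulr_suml lerD2l -mulrA ler_wpM2r//.
  by rewrite divr_ge0 ?powR_ge0// ltW.
have {H} : C * (X / C) `^ p <= \sum_(0 <= n < N) lam n * t n `^ p.
  move: H; rewrite zX -lerBlDr -[X in X - _]mulr1 -pq mulrDr -addrA subrr addr0.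
  by rewrite ler_pM2r// invr_gt0.
move/(ler_wpM2l (powR_ge0 C (p - 1))); apply: le_trans.
rewrite mulrA [C `^ _ * C]mulrC mulr_powRB1 ?(ltW C0)// -powRM ?(ltW C0)//.
by rewrite mulrCA mulfV ?mulr1// gt_eqF.
Qed.

Lemma sin_pi_sym s : sin (pi * (1 - s)) = sin (pi * s).
Proof. by rewrite mulrBr mulr1 sinB sinpi cospi mul0r sub0r mulN1r opprK. Qed.

Lemma csc_gt0 s : 0 < s < 1 -> 0 < pi / sin (pi * s).
Proof. by move=> hs; rewrite divr_gt0 ?pi_gt0// sin_pi_gt0. Qed.

Lemma hilbert_kernel_sym s k n : hilbert_kernel (s - 1) k n = hilbert_kernel (1 - s) n k :> R.
Proof.
rewrite /hilbert_kernel addnC -[k%:R / n%:R in LHS]invf_div powR_invl ?divr_ge0//.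
by rewrite opprB.
Qed.

Lemma hilbert_kernelD s t k n : (0 < k)%N -> (0 < n)%N ->
  hilbert_kernel (s + t) k n = hilbert_kernel s k n * (k%:R / n%:R) `^ t.
Proof.
move=> k0 n0; have kn : 0 < k%:R / n%:R :> R by rewrite divr_gt0 ?ltr0n.
by rewrite /hilbert_kernel powRD ?(gt_eqF kn) ?implybT// mulrAC.
Qed.

(** Pulling out (n/k)^(1/p) raises the exponent from gamma to s, and rows contribute C^(p-1). After
    the p-th power the factor n/k lowers it to s - 1, which is the transposed kernel with exponent 1
    - s; columns contribute the same C since the sine is symmetric about a half turn. Nothing is
    lost in the product C^p. *)
Lemma hilbert_schur p gamma b K N : 1 < p -> 0 < p^-1 + gamma < 1 ->
  (forall n, 0 <= b n) ->
  \sum_(0 <= k < K) (\sum_(0 <= n < N) hilbert_kernel gamma k.+1 n.+1 * b n) `^ p <=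
    (pi / sin (pi * (p^-1 + gamma))) `^ p * \sum_(0 <= n < N) b n `^ p.
Proof.
move=> p1 hs b0; set s := p^-1 + gamma; set C := pi / sin (pi * s).
have C0 : 0 < C by exact: csc_gt0.
have p0 : 0 < p by exact: lt_trans p1.
have hs' : 0 < 1 - s < 1 by move: hs; rewrite -/s => /andP[? ?]; apply/andP; split; lra.
apply: (@le_trans _ _ (\sum_(0 <= k < K) C `^ (p - 1) *
    \sum_(0 <= n < N) hilbert_kernel (1 - s) n.+1 k.+1 * b n `^ p)).
  apply: ler_sum => k _.
  have E n : hilbert_kernel gamma k.+1 n.+1 * b n =
      hilbert_kernel s k.+1 n.+1 * ((n.+1%:R / k.+1%:R) `^ p^-1 * b n).
    rewrite /s addrC hilbert_kernelD// -!mulrA; congr (_ * _).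
    rewrite -[k.+1%:R / n.+1%:R]invf_div powR_invl ?divr_ge0// powRN.
    have nk : 0 < (n.+1%:R / k.+1%:R : R) `^ p^-1 by rewrite powR_gt0// divr_gt0.
    by rewrite mulKf// gt_eqF.
  under eq_bigr do rewrite E.
  apply: (le_trans (power_mean_le p1 C0 _ _ _)).
  - by move=> n; exact: hilbert_kernel_ge0.
  - by move=> n; rewrite mulr_ge0// powR_ge0.
  - exact: hilbert_kernel_sum_le.
  rewrite ler_wpM2l ?powR_ge0//; apply: ler_sum => n _.
  rewrite powRM ?powR_ge0// -powRrM mulVf ?gt_eqF// powRr1 ?divr_ge0//.
  rewrite mulrA -hilbert_kernel_sym hilbert_kernelD//.
  by rewrite -[k.+1%:R / n.+1%:R]invf_div powR_invl ?divr_ge0// opprK powRr1 ?divr_ge0.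
rewrite -mulr_sumr exchange_big_nat /=.
rewrite -[C `^ p](mulr_powRB1 (ltW C0) p0) [C * _]mulrC -mulrA ler_wpM2l ?powR_ge0//.
rewrite mulr_sumr; apply: ler_sum => n _.
rewrite -mulr_suml ler_wpM2r ?powR_ge0//.
by apply: (le_trans (hilbert_kernel_sum_le _ hs' _)) => //; rewrite sin_pi_sym.
Qed.

(** One factor r comes from (i/j)^gamma, because the exponent has absolute value at most 1, the
    other from the denominators n + i and n + j. *)
Lemma hilbert_kernel_comparable gamma (r : R) (i j n : nat) : `|gamma| <= 1 -> 1 <= r ->
  (0 < i)%N -> (0 < j)%N -> (0 < n)%N -> i%:R <= r * j%:R -> j%:R <= r * i%:R ->
  hilbert_kernel gamma i n <= r ^+ 2 * hilbert_kernel gamma j n.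
Proof.
move=> g1 r1 i0 j0 n0 ij ji; have r0 : 0 < r by exact: lt_le_trans r1.
have i0' : 0 < i%:R :> R by rewrite ltr0n.
have j0' : 0 < j%:R :> R by rewrite ltr0n.
have n0' : 0 < n%:R :> R by rewrite ltr0n.
have aux (e x : R) : 0 <= e <= 1 -> 0 < x <= r -> x `^ e <= r.
  move=> /andP[e0 e1] /andP[x0 xr].
  by rewrite (le_trans (ler_powRl e0 (ltW x0) xr))// ler1_powR.
have H : (i%:R / j%:R) `^ gamma <= r.
  move: g1; rewrite ler_norml => /andP[g1 g2]; have [g0|g0] := lerP 0 gamma.
    by apply: aux; rewrite ?g0// divr_gt0//= ler_pdivrMr.
  rewrite -[i%:R / j%:R]invf_div powR_invl ?divr_ge0//.
  apply: aux; last by rewrite divr_gt0//= ler_pdivrMr.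
  by apply/andP; split; lra.
rewrite /hilbert_kernel.
have -> : i%:R / n%:R = (i%:R / j%:R) * (j%:R / n%:R) :> R.
  by rewrite mulrA divfK// gt_eqF.
rewrite powRM ?divr_ge0// expr2 -!mulrA; apply: ler_pM; rewrite ?powR_ge0//.
rewrite mulrCA ler_wpM2l ?powR_ge0// ler_pdivlMr ?ltr0n ?addn_gt0 ?n0//.
rewrite mulrC ler_pdivrMr ?ltr0n ?addn_gt0 ?n0// !natrD mulrDr lerD//.
by rewrite ler_peMl.
Qed.

(** If X varies by a factor at most r, the average of w X is at most r times the product of the
    averages. Denominators are cleared; [block_sum_ge] is the reverse comparison. *)
Lemma block_sum_le w X (r : R) (A B : nat) : (A <= B)%N -> (forall k, 0 <= w k) ->
  (forall i j, (A <= i < B)%N -> (A <= j < B)%N -> X i <= r * X j) ->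
  (B%:R - A%:R) * \sum_(A <= k < B) w k * X k <=
    r * ((\sum_(A <= k < B) w k) * \sum_(A <= k < B) X k).
Proof.
move=> AB w0 hX; rewrite mulrC -natrB// mulr_suml mulr_suml mulr_sumr.
apply: ler_sum_nat => i iAB; have -> : r * (w i * \sum_(A <= k < B) X k) = w i * (r * \sum_(A <= k < B) X k) by ring.
rewrite -mulrA ler_wpM2l//.
apply: (@le_trans _ _ (\sum_(A <= j < B) X i)); first by rewrite sumr_const_nat mulr_natr.
by rewrite mulr_sumr; apply: ler_sum_nat => j jAB; exact: hX.
Qed.

Lemma block_sum_ge w X (r : R) (A B : nat) : (A <= B)%N -> (forall k, 0 <= w k) ->
  (forall i j, (A <= i < B)%N -> (A <= j < B)%N -> X j <= r * X i) ->
  (\sum_(A <= k < B) w k) * \sum_(A <= k < B) X k <=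
  r * ((B%:R - A%:R) * \sum_(A <= k < B) w k * X k).
Proof.
move=> AB w0 hX; rewrite [_ * \sum_(_ <= _ < _) _ * _]mulrC -natrB// !mulr_suml mulr_sumr.
apply: ler_sum_nat => i iAB.
have -> : r * (w i * X i * (B - A)%:R) = w i * (r * X i * (B - A)%:R) by ring.
rewrite ler_wpM2l//.
apply: (@le_trans _ _ (\sum_(A <= j < B) r * X i)); last by rewrite sumr_const_nat mulr_natr.
by apply: ler_sum_nat => j jAB; exact: hX.
Qed.

Definition harmonic_sum (A B : nat) : R := \sum_(A <= k < B) k%:R^-1.

Lemma harmonic_sum_ge0 A B : 0 <= harmonic_sum A B.
Proof. by apply: sumr_ge0 => k _; rewrite invr_ge0. Qed.

Lemma harmonic_sum_cat A B D : (A <= B)%N -> (B <= D)%N ->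
  harmonic_sum A D = harmonic_sum A B + harmonic_sum B D.
Proof. by move=> AB BD; rewrite /harmonic_sum (@big_cat_nat _ _ _ B). Qed.

(** The true order is log r; what matters is a bound independent of B. *)
Lemma harmonic_sum_dilate (B r : nat) : (0 < B)%N -> (0 < r)%N -> harmonic_sum B (B * r) <= r%:R.
Proof.
move=> B0 r0; apply: (@le_trans _ _ (\sum_(B <= k < B * r) B%:R^-1)).
  apply: ler_sum_nat => k /andP[Bk _].
  by rewrite lef_pV2 ?posrE ?ltr0n ?ler_nat// (leq_trans B0).
rewrite sumr_const_nat -[leLHS]mulr_natl ler_pdivrMr ?ltr0n// -natrM ler_nat.
by rewrite mulnC leq_subr.
Qed.

Lemma harmonic_sum_unbounded A (x : R) : (0 < A)%N ->
  exists B0 : nat, (A <= B0)%N /\ forall B, (B0 <= B)%N -> x <= harmonic_sum A B.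
Proof.
move=> A0.
have H j : j%:R / 2 <= harmonic_sum A (A * 2 ^ j).
  elim: j => [|j IH]; first by rewrite mul0r harmonic_sum_ge0.
  have Aj : (0 < A * 2 ^ j)%N by rewrite muln_gt0 A0 expn_gt0.
  have jj : (A * 2 ^ j <= A * 2 ^ j.+1)%N by rewrite leq_mul2l leq_exp2l// leqnSn orbT.
  rewrite (@harmonic_sum_cat _ (A * 2 ^ j)) ?leq_pmulr ?expn_gt0// natS mulrDl lerD//.
  apply: (@le_trans _ _ (\sum_(A * 2 ^ j <= k < A * 2 ^ j.+1) (A * 2 ^ j.+1)%:R^-1)).
    rewrite sumr_const_nat -[leRHS]mulr_natl expnS mulnCA mul2n -addnn addnK addnn -muln2.
    move: (A * 2 ^ j)%N Aj => m m0.
    by rewrite natrM mul1r invfM mulrA mulfV ?mul1r// pnatr_eq0 -lt0n.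
  apply: ler_sum_nat => k /andP[h1 h2].
  by rewrite lef_pV2 ?posrE ?ltr0n ?ler_nat ?(leq_trans Aj)// ltnW.
pose j := (Num.truncn (x * 2)).+1.
exists (A * 2 ^ j)%N; split; first by rewrite leq_pmulr ?expn_gt0.
move=> B AB; rewrite (@harmonic_sum_cat _ (A * 2 ^ j)) ?leq_pmulr ?expn_gt0//.
rewrite (le_trans _ (lerD (H j) (harmonic_sum_ge0 _ _)))// addr0.
by rewrite ler_pdivlMr// ltW// truncnS_gt.
Qed.

(* The test sequence is n^(-1/p) on a long interval [N, M[: both its norm and
   the weighted norm of its image are governed by harmonic sums, up to the two
   ends of the interval, which contribute a bounded amount. *)
Lemma hilbert_test_sequence p gamma w (Lam theta : R) :
  1 < p -> 0 < p^-1 + gamma < 1 -> (forall k, 0 <= w k) ->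
  (forall A0, exists2 A, (A0 <= A)%N & forall B0, exists2 B, (B0 <= B)%N &
     Lam * harmonic_sum A B <= \sum_(A <= k < B) w k / k%:R) ->
  0 <= theta -> 0 < Lam ->
  theta `^ p < (pi / sin (pi * (p^-1 + gamma))) `^ p * Lam ->
  forall N0, exists N M A B, [/\ (N0 < N)%N, (0 < A)%N, (A <= B)%N, (N < M)%N &
    theta `^ p * harmonic_sum N M <=
    \sum_(A <= k < B) w k *
       (\sum_(N <= n < M) hilbert_kernel gamma k n * n%:R `^ (- p^-1)) `^ p].
Proof.
move=> p1 hs w0 dens th0 L0 thC N0; set s := p^-1 + gamma in hs thC *.
set C := pi / sin (pi * s) in thC.
have C0 : 0 < C by exact: csc_gt0.
have p0 : 0 < p by exact: lt_trans p1.
have pN : p != 0 by rewrite gt_eqF.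
(* A row sum of c0 would just produce theta. The strict margin between c0 and C leaves room for a c
   between them, and the surplus c^p Lam - theta^p pays for the two ends of the interval. *)
pose c0 := theta / Lam `^ p^-1.
have La0 : 0 < Lam `^ p^-1 by rewrite powR_gt0.
have c00 : 0 <= c0 by rewrite divr_ge0// ltW.
have LaE : (Lam `^ p^-1) `^ p = Lam by rewrite -powRrM mulVf// powRr1// ltW.
have c0C : c0 < C.
  rewrite ltr_pdivrMr// ltNge; apply/negP => h.
  move: thC; rewrite -LaE -powRM ?(ltW C0) ?(ltW La0)// ltNge.
  by rewrite ler_powRl// ?ltW// mulr_gt0.
pose c := (c0 + C) / 2.
have cc0 : c0 < c by rewrite /c; lra.
have cC : c < C by rewrite /c; lra.
have c_gt0 : 0 < c by exact: le_lt_trans cc0.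
have thc : theta `^ p < c `^ p * Lam.
  rewrite -LaE -powRM ?(ltW c_gt0) ?(ltW La0)// gt0_ltr_powR ?nnegrE ?(mulr_ge0 (ltW _) (ltW _))//.
  by rewrite -ltr_pdivrMr.
have [r [r0 hr]] := hilbert_kernel_sum_ge hs cC.
(* A is taken so large that N, its quotient by r, still exceeds N0; rows from A on then see the
   whole relevant range below them. *)
have [A A0 hA] := dens (r * N0.+1)%N.
pose N := (A %/ r)%N.
have NN : (N0 < N)%N by rewrite leq_divRL// mulnC.
have N_gt0 : (0 < N)%N by exact: leq_ltn_trans NN.
have NrA : (N * r <= A)%N by exact: leq_trunc_div.
have NA : (N <= A)%N by rewrite (leq_trans _ NrA)// leq_pmulr.
have A_gt0 : (0 < A)%N by exact: leq_trans NA.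
have del : 0 < c `^ p * Lam - theta `^ p by rewrite subr_gt0.
(* The support [N, B r[ is longer than the row range [A, B[. Its excess has harmonic sum at most
   [harmonic_sum N A + r%:R], and B is chosen so that the surplus over [A, B[ outweighs it. *)
have [B0 [_ hB0]] := harmonic_sum_unbounded
   (theta `^ p * (harmonic_sum N A + r%:R) / (c `^ p * Lam - theta `^ p)) A_gt0.
have [B] := hA (maxn B0 A.+1).
rewrite geq_max => /andP[B0B AB'] hB.
have AB := ltnW AB'.
have B_gt0 : (0 < B)%N by exact: leq_trans AB.
have BBr : (B <= B * r)%N by rewrite leq_pmulr.
exists N, (B * r)%N, A, B; split => //; first exact: leq_ltn_trans NA (leq_trans AB' BBr).
apply: (@le_trans _ _ (c `^ p * (Lam * harmonic_sum A B))); last first.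
  apply: (@le_trans _ _ (c `^ p * \sum_(A <= k < B) w k / k%:R)).
    by rewrite ler_wpM2l// powR_ge0.
  rewrite mulr_sumr; apply: ler_sum_nat => k /andP[Ak kB].
  have k0 : (0 < k)%N by exact: leq_trans Ak.
  have k0' : 0 < k%:R :> R by rewrite ltr0n.
  rewrite mulrCA ler_wpM2l//.
  have -> : c `^ p / k%:R = (c * k%:R `^ (- p^-1)) `^ p.
    rewrite powRM ?powR_ge0// ?ltW//.
    by rewrite -[in RHS]powRrM mulNr mulVf// powR_inv1// ltW.
  apply: ler_powRl (ltW p0) (mulr_ge0 (ltW c_gt0) (powR_ge0 _ _)) _.
  (* The sequence n^(-1/p) is an approximate eigenvector: the kernel of exponent gamma times
     n^(-1/p) is the kernel of exponent s times k^(-1/p). *)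
  have -> : \sum_(N <= n < B * r) hilbert_kernel gamma k n * n%:R `^ (- p^-1) =
      (\sum_(N <= n < B * r) hilbert_kernel s k n) * k%:R `^ (- p^-1).
    rewrite mulr_suml; apply: eq_big_nat => n /andP[Nn _].
    have n0 : (0 < n)%N by exact: leq_trans Nn.
    have n0' : 0 < n%:R :> R by rewrite ltr0n.
    rewrite /s addrC hilbert_kernelD// -mulrA; congr (_ * _).
    rewrite powRM ?invr_ge0// powR_invl// mulrC mulrA -powRD ?addNr ?powRr0 ?mul1r//.
    by rewrite eqxx /= gt_eqF.
  rewrite ler_wpM2r ?powR_ge0//; apply: hr => //.
    exact: leq_trans Ak.
  by rewrite leq_mul2r ltnW ?orbT.
have H1 : harmonic_sum N (B * r) <= harmonic_sum N A + r%:R + harmonic_sum A B.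
  rewrite (harmonic_sum_cat NA) ?(leq_trans AB)// (harmonic_sum_cat AB)//.
  by have := harmonic_sum_dilate B_gt0 r0; lra.
apply: (le_trans (ler_wpM2l (powR_ge0 _ _) H1)).
move: (hB0 B B0B); rewrite ler_pdivrMr// => H2; nra.
Qed.

End Schur.

(** * The space l^p *)

Section LpSpace.
Context {R : realType}.
Implicit Types (p M c : R) (a b : nat -> R[i]) (z : R[i]).

Lemma modulus_ge0 z : 0 <= modulus z.
Proof. by case: z => x y; exact: sqrtr_ge0. Qed.

Lemma modulus0 : modulus (0 : R[i]) = 0.
Proof. exact: ComplexField.Normc.normc0. Qed.

Lemma modulus1 : modulus (1 : R[i]) = 1.
Proof. exact: ComplexField.Normc.normc1. Qed.

Lemma modulusM z z' : modulus (z * z') = modulus z * modulus z'.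
Proof. exact: ComplexField.Normc.normcM. Qed.

Lemma modulus_real (x : R) : modulus x%:C = `|x|.
Proof. by rewrite /modulus /= expr0n /= addr0 sqrtr_sqr. Qed.

Lemma modulusN z : modulus (- z) = modulus z.
Proof. exact: normcN. Qed.

Lemma modulusD z z' : modulus (z + z') <= modulus z + modulus z'.
Proof. exact: le_normcD. Qed.

Lemma norm_modulus z : `|z| = (modulus z)%:C.
Proof. by []. Qed.

Lemma lpnorm_ge0 p a : (0 <= lpnorm p a)%E.
Proof. exact: Lnorm_ge0. Qed.

Lemma eq_lpnorm p a b : (forall n, modulus (a n) = modulus (b n)) -> lpnorm p a = lpnorm p b.
Proof. by move=> ab; apply: eq_Lnorm => n; rewrite ab. Qed.

Lemma lpnormE p a : 0 < p ->
  lpnorm p a = ((\sum_(0 <= k <oo) (modulus (a k) `^ p)%:E) `^ p^-1)%E.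
Proof.
move=> p0; rewrite /lpnorm Lnorm_counting//; congr (_ `^ _)%E.
by apply: eq_eseriesr => k _; rewrite poweR_EFin ger0_norm ?modulus_ge0.
Qed.

(** The passage between the extended-real norm and finite real sums, through which the later norm
    estimates go. *)
Lemma lpnorm_leP p M a : 0 < p -> 0 <= M ->
  (lpnorm p a <= M%:E)%E <-> forall N, \sum_(0 <= n < N) modulus (a n) `^ p <= M `^ p.
Proof.
move=> p0 M0; rewrite lpnormE//.
have pV : p^-1 != 0 by rewrite invr_neq0// gt_eqF.
have f0 n : (0 <= (modulus (a n) `^ p)%:E)%E by rewrite lee_fin powR_ge0.
have pp (x : R) : 0 <= x -> (x `^ p^-1) `^ p = x.
  by move=> x0; rewrite -powRrM mulVf ?gt_eqF// powRr1.
split=> [H N|H].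
  have L := @nneseries_lim_ge R _ xpredT 0%N N (fun n _ _ => f0 n).
  have S0 : (0 <= \sum_(0 <= k <oo) (modulus (a k) `^ p)%:E)%E by exact: nneseries_ge0.
  move: L S0 H; case: (limn _) => [s| |]//; last first.
    by move=> _ _; rewrite poweRE (negbTE pV) eqxx.
  rewrite sumEFin !lee_fin => L s0 H.
  rewrite (le_trans L)// -(pp s s0); apply: ler_powRl => //; first exact: ltW.
  exact: powR_ge0.
have : (\sum_(0 <= k <oo) (modulus (a k) `^ p)%:E <= (M `^ p)%:E)%E.
  apply: lime_le; first by apply: is_cvg_nneseries => *; exact: f0.
  by apply: nearW => N; rewrite sumEFin lee_fin.
have S0 : (0 <= \sum_(0 <= k <oo) (modulus (a k) `^ p)%:E)%E by exact: nneseries_ge0.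
move: S0; case: (limn _) => [s| |]//.
rewrite !lee_fin => s0 H1.
apply: (@le_trans _ _ ((M `^ p) `^ p^-1)); last by rewrite -powRrM mulfV ?gt_eqF// powRr1.
by apply: ler_powRl; rewrite ?invr_ge0 ?(ltW p0).
Qed.

Lemma lpnorm_geP p (t : R) N a : 0 < p -> 0 <= t ->
  t `^ p <= \sum_(0 <= n < N) modulus (a n) `^ p -> (t%:E <= lpnorm p a)%E.
Proof.
move=> p0 t0 H; case E : (lpnorm p a) => [r| |]; last 2 first.
- exact: leey.
- by have := lpnorm_ge0 p a; rewrite E.
have r0 : 0 <= r by rewrite -lee_fin -E lpnorm_ge0.
have /(lpnorm_leP _ p0 r0)/(_ N) h : (lpnorm p a <= r%:E)%E by rewrite E.
rewrite lee_fin leNgt; apply/negP => rt.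
by have := le_trans H h; rewrite leNgt gt0_ltr_powR ?nnegrE.
Qed.

Lemma in_lpP p a : in_lp p a -> exists2 m : R, 0 <= m & lpnorm p a = m%:E.
Proof.
rewrite /in_lp; have := lpnorm_ge0 p a; case: (lpnorm p a) => [r| |]// r0 _.
by exists r.
Qed.

Lemma lpnorm_sum_le p m a N : 0 < p -> 0 <= m -> lpnorm p a = m%:E ->
  \sum_(0 <= n < N) modulus (a n) `^ p <= m `^ p.
Proof. by move=> p0 m0 am; apply: (lpnorm_leP a p0 m0).1; rewrite am. Qed.

Lemma le_lpnorm p a b : 0 < p -> (forall n, modulus (a n) <= modulus (b n)) ->
  (lpnorm p a <= lpnorm p b)%E.
Proof.
move=> p0 ab; case E : (lpnorm p b) => [r| |]; last 2 first.
- exact: leey.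
- by have := lpnorm_ge0 p b; rewrite E.
have r0 : 0 <= r by rewrite -lee_fin -E lpnorm_ge0.
apply/(lpnorm_leP _ p0 r0) => N; apply: le_trans (lpnorm_sum_le N p0 r0 E).
by apply: ler_sum => n _; apply: ler_powRl; [exact: ltW|exact: modulus_ge0|].
Qed.

Lemma lpnormD p a b : 1 <= p -> (lpnorm p (fun n => (a n + b n)%R) <= lpnorm p a + lpnorm p b)%E.
Proof.
move=> p1; have p0 : 0 < p by exact: lt_le_trans p1.
have ma (c : nat -> R) : measurable_fun setT c by [].
apply: le_trans (minkowski_EFin counting (ma (modulus \o a)) (ma (modulus \o b)) p1).
have -> : 'N[counting]_p%:E[EFin \o ((modulus \o a) \+ (modulus \o b))%R]%E =
    lpnorm p (fun n => (modulus (a n) + modulus (b n))%:C).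
  have E n : modulus (modulus (a n) + modulus (b n))%:C = modulus (a n) + modulus (b n).
    by rewrite modulus_real ger0_norm// addr_ge0// modulus_ge0.
  by apply: eq_Lnorm => n; exact: (congr1 EFin (esym (E n))).
apply: le_lpnorm => // n.
by rewrite modulus_real ger0_norm ?addr_ge0 ?modulus_ge0// modulusD.
Qed.

Lemma lpnormZ p (c : R[i]) a m : 0 < p -> 0 <= m -> (lpnorm p a <= m%:E)%E ->
  (lpnorm p (fun n => (c * a n)%R) <= (modulus c * m)%:E)%E.
Proof.
move=> p0 m0 am; have c0 := modulus_ge0 c.
apply/(lpnorm_leP _ p0 (mulr_ge0 c0 m0)) => N.
under eq_bigr do rewrite modulusM powRM ?modulus_ge0//.
rewrite -mulr_sumr powRM// ler_wpM2l ?powR_ge0//.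
exact: (lpnorm_leP a p0 m0).1.
Qed.

Lemma lpnormN p a : lpnorm p (fun n => (- a n)%R) = lpnorm p a.
Proof. by apply: eq_lpnorm => n; rewrite modulusN. Qed.

Lemma in_lpD p a b : 1 <= p -> in_lp p a -> in_lp p b -> in_lp p (fun n => (a n + b n)%R).
Proof. by move=> p1 ha hb; rewrite /in_lp (le_lt_trans (lpnormD _ _ p1))// lte_add_pinfty. Qed.

Lemma in_lpZ p (c : R[i]) a : 0 < p -> in_lp p a -> in_lp p (fun n => (c * a n)%R).
Proof.
move=> p0 /in_lpP[m m0 am]; apply: (@le_lt_trans _ _ (modulus c * m)%:E); last exact: ltry.
by apply: lpnormZ => //; rewrite am.
Qed.

Lemma lpnorm0 p : 0 < p -> lpnorm p (fun=> 0 : R[i]) = 0%E.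
Proof.
move=> p0; apply/eqP; rewrite eq_le lpnorm_ge0 andbT; apply/(lpnorm_leP _ p0 (lexx 0)) => N.
by rewrite big1// => n _; rewrite modulus0 powR0 ?gt_eqF// powR_ge0.
Qed.

Lemma in_lp0 p : 0 < p -> in_lp p (fun=> 0 : R[i]).
Proof. by move=> p0; rewrite /in_lp lpnorm0// ltry. Qed.

Lemma cvg_lpnorm0P p (u : nat -> nat -> R[i]) :
  lpnorm p (u j) @[j --> \oo] --> 0%E <->
  forall e : R, 0 < e -> \forall j \near \oo, (lpnorm p (u j) <= e%:E)%E.
Proof.
split=> [/fine_cvgP[fin cv] e e0|H].
  have := cv; rewrite cvgr0Pnorm_le => /(_ e e0) h.
  near=> j; have fj : lpnorm p (u j) \is a fin_num by near: j.
  rewrite -(fineK fj) lee_fin; apply: (le_trans (ler_norm _)); near: j.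
  exact: h.
apply/fine_cvgP; split.
  near=> j; have : (lpnorm p (u j) <= 1%:E)%E by near: j; exact: H.
  by move=> h; rewrite ge0_fin_numE ?lpnorm_ge0// (le_lt_trans h)// ltry.
apply/cvgr0Pnorm_le => e e0; near=> j.
have h : (lpnorm p (u j) <= e%:E)%E by near: j; exact: H.
have fj : lpnorm p (u j) \is a fin_num.
  by rewrite ge0_fin_numE ?lpnorm_ge0// (le_lt_trans h)// ltry.
rewrite ger0_norm ?fine_ge0 ?lpnorm_ge0//.
by rewrite -lee_fin fineK.
Unshelve. all: by end_near. Qed.

Lemma opnorm_le p Q (S : (nat -> R[i]) -> (nat -> R[i])) :
  (forall a, (lpnorm p a <= 1)%E -> (lpnorm p (S a) <= Q)%E) -> (opnorm p S <= Q)%E.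
Proof. by move=> H; apply: ge_ereal_sup => _ [a a1 <-]; exact: H. Qed.

Lemma lpnorm_le_opnorm p (S : (nat -> R[i]) -> (nat -> R[i])) a :
  (lpnorm p a <= 1)%E -> (lpnorm p (S a) <= opnorm p S)%E.
Proof. by move=> a1; apply: ereal_sup_ubound; exists a. Qed.

Lemma essnorm_le p (S T : (nat -> R[i]) -> (nat -> R[i])) (Q : \bar R) : compact_op p T ->
  (forall a, (lpnorm p a <= 1)%E -> (lpnorm p (S a \- T a)%R <= Q)%E) -> (essnorm p S <= Q)%E.
Proof.
move=> cT H; apply: (@le_trans _ _ (opnorm p (fun a => (S a \- T a)%R))).
  by apply: ereal_inf_lbound; exists T.
exact: opnorm_le.
Qed.

End LpSpace.

(** * Convergence of complex series through moduli, real and imaginary parts *)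

Section ComplexSeries.
Context {R : realType}.
Implicit Types (u : nat -> R[i]) (z : R[i]).

Lemma cvgn_complexP (u : nat -> R[i]) (z : R[i]) :
  (u : nat -> (R[i] : numFieldType)) n @[n --> \oo] --> (z : (R[i] : numFieldType)) <->
  modulus (z - u n) @[n --> \oo] --> (0 : R).
Proof.
split=> [cv|cv].
  apply/cvgr0Pnorm_lt => e e0.
  have e0' : 0 < e%:C by rewrite ltcR.
  move: cv => /(cvgrPdist_lt (V := (R[i] : numFieldType)))/(_ _ e0'); apply: filterS => n.
  by rewrite norm_modulus ltcR ger0_norm// modulus_ge0.
(* A positive element of R[i] has zero imaginary part, so the radius is in fact a real number. *)
apply/(cvgrPdist_lt (V := (R[i] : numFieldType))) => -[e e'].
rewrite ltcE /= => /andP[/eqP-> e0].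
move: cv => /cvgr0Pnorm_lt/(_ _ e0); apply: filterS => n.
by rewrite norm_modulus ger0_norm ?modulus_ge0// ltcR.
Qed.

Lemma modulus_le_Re_Im z : modulus z <= `|complex.Re z| + `|complex.Im z|.
Proof.
case: z => x y; rewrite [complex.Re _]/= [complex.Im _]/=; have -> : x +i* y = x%:C + 'i%C * y%:C by simpc.
apply: (le_trans (modulusD _ _)); rewrite modulusM !modulus_real.
by rewrite /modulus /= expr0n /= add0r expr1n sqrtr1 mul1r.
Qed.

Lemma Re_le_modulus z : `|complex.Re z| <= modulus z.
Proof. by have := normc_ge_Re z; rewrite norm_modulus lecR. Qed.

Lemma Im_le_modulus z : `|complex.Im z| <= modulus z.
Proof.
have := Re_le_modulus ('i%C * z); rewrite modulusM mulrC ReiNIm normrN.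
by rewrite /modulus /= expr0n /= add0r expr1n sqrtr1 mul1r.
Qed.

Lemma series_complexE u N : series u N =
  (\sum_(0 <= n < N) complex.Re (u n)) +i* (\sum_(0 <= n < N) complex.Im (u n)).
Proof.
rewrite /series /=; elim: N => [|N IH]; first by rewrite !big_geq.
by rewrite !big_nat_recr//= IH; case: (u N) => x y.
Qed.

Lemma cvg_complex_series u (B : R) :
  (forall N, \sum_(0 <= n < N) modulus (u n) <= B) ->
  exists l : R[i], modulus (l - series u N) @[N --> \oo] --> (0 : R).
Proof.
move=> hB.
have aux (f : nat -> R) : (forall n, `|f n| <= modulus (u n)) -> cvgn (series f).
  move=> fu; apply: normed_cvg; apply: nondecreasing_is_cvgn.
    apply/nondecreasing_seqP => n.
    have -> : [normed series f] n.+1 = [normed series f] n + `|f n| by exact: big_nat_recr.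
    by rewrite lerDl.
  exists B => _ [n _ <-]; rewrite /series /=; apply: le_trans (hB n).
  exact: ler_sum.
have hr := aux _ (fun n => Re_le_modulus (u n)).
have hi := aux _ (fun n => Im_le_modulus (u n)).
set f := fun n => complex.Re (u n) in hr; set h := fun n => complex.Im (u n) in hi.
exists (limn (series f) +i* limn (series h)).
apply/cvgr0Pnorm_lt => e e0; have e2 : 0 < e / 2 by rewrite divr_gt0.
move: hr => /cvgrPdist_lt/(_ _ e2) hr; move: hi => /cvgrPdist_lt/(_ _ e2) hi.
near=> N.
have h1 : `|limn (series f) - series f N| < e / 2 by near: N.
have h2 : `|limn (series h) - series h N| < e / 2 by near: N.
rewrite ger0_norm ?modulus_ge0// series_complexE [e]splitr.
apply: (le_lt_trans (modulus_le_Re_Im _)) => /=; exact: ltrD.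
Unshelve. all: by end_near. Qed.

Lemma lim_complex (u : nat -> R[i]) (z : R[i]) :
  modulus (z - u n) @[n --> \oo] --> (0 : R) ->
  limn (u : nat -> (R[i] : numFieldType)) = z.
Proof. by move=> h; apply: cvg_lim; [exact: norm_hausdorff|apply/cvgn_complexP]. Qed.

Lemma cvg_powR (x : nat -> R) (y p : R) : 0 < p -> (forall n, 0 <= x n) ->
  x n @[n --> \oo] --> y -> x n `^ p @[n --> \oo] --> y `^ p.
Proof.
move=> p0 x0 xy; have : 0 <= y by apply: (cvgr_to_ge xy); exact: nearW.
rewrite le_eqVlt => /predU1P[y0|y0].
  rewrite -y0 in xy *; rewrite powR0 ?gt_eqF//; apply/cvgr0Pnorm_lt => e e0.
  have e1 : 0 < e `^ p^-1 by rewrite powR_gt0.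
  move: xy => /cvgr0Pnorm_lt/(_ _ e1); apply: filterS => n.
  rewrite !ger0_norm ?powR_ge0// => h.
  have -> : e = (e `^ p^-1) `^ p by rewrite -powRrM mulVf ?gt_eqF// powRr1// ltW.
  by rewrite gt0_ltr_powR ?nnegrE// ltW.
have pc : {for y, continuous (fun t => t `^ p)}.
  apply: differentiable_continuous; apply/derivable1_diffP.
  by apply: derivable_powR; rewrite in_itv /= y0.
exact: (continuous_cvg _ pc xy).
Qed.

(** A finite form of Fatou's lemma: with K rows fixed, a bound on the sections with N columns
    survives N going to infinity. *)
Lemma modulus_lim_sum_le (K : nat) (z : nat -> nat -> R[i]) (l : nat -> R[i]) (p Q : R) :
  0 < p -> (forall k, modulus (l k - z N k) @[N --> \oo] --> (0 : R)) ->
  (forall N, \sum_(0 <= k < K) modulus (z N k) `^ p <= Q) ->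
  \sum_(0 <= k < K) modulus (l k) `^ p <= Q.
Proof.
move=> p0 zl hQ.
have H : \sum_(0 <= k < K) modulus (z N k) `^ p @[N --> \oo] -->
    \sum_(0 <= k < K) modulus (l k) `^ p.
  elim: K {hQ} => [|K IH].
    by rewrite big_geq//; under eq_fun do rewrite big_geq//; exact: cvg_cst.
  rewrite big_nat_recr//=; under eq_fun do rewrite big_nat_recr//=.
  apply: cvgD => //; apply: cvg_powR => // [n|]; first exact: modulus_ge0.
  apply/cvgrPdist_lt => e e0.
  move: (zl K) => /cvgr0Pnorm_lt/(_ _ e0); apply: filterS => N.
  rewrite ger0_norm ?modulus_ge0// ltr_norml => he.
  have h1 := modulusD (l K - z N K) (z N K); rewrite subrK in h1.
  have h2 := modulusD (z N K - l K) (l K); rewrite subrK -opprB modulusN in h2.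
  by apply/andP; split; lra.
by apply: (cvgr_to_le H); exact: nearW.
Qed.

End ComplexSeries.

(** * The operator H *)

Section HilbertOperator.
Context {R : realType}.
Context (p gamma : R) (p1 : 1 < p) (hs : 0 < p^-1 + gamma < 1).
Implicit Types (g a : nat -> R[i]) (b : nat -> R).

Let C := pi / sin (pi * (p^-1 + gamma)).

Let p0 : 0 < p. Proof. exact: lt_trans p1. Qed.
Let C0 : 0 < C. Proof. exact: csc_gt0. Qed.

Definition hilbert_term g a (k n : nat) : R[i] :=
  (hilbert_kernel gamma k.+1 n.+1)%:C * (g k * a n).

Lemma hilbert_opE g a k : hilbert_op g gamma a k =
  limn (series (hilbert_term g a k) : nat -> (R[i] : numFieldType)).
Proof.
congr (limn (series _ : nat -> (R[i] : numFieldType))); apply/funext => n.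
rewrite /hilbert_term /hilbert_kernel rmorphM /= fmorphV /= rmorph_nat; ring.
Qed.

Lemma modulus_hilbert_term g a k n : modulus (hilbert_term g a k n) =
  modulus (g k) * (hilbert_kernel gamma k.+1 n.+1 * modulus (a n)).
Proof.
by rewrite !modulusM modulus_real ger0_norm ?hilbert_kernel_ge0// mulrCA.
Qed.

(** A single row is at most the p-sum of all rows in the Schur test. This gives absolute convergence
    of every entry. *)
Lemma hilbert_row_le a m k N : 0 <= m -> lpnorm p a = m%:E ->
  \sum_(0 <= n < N) hilbert_kernel gamma k.+1 n.+1 * modulus (a n) <= C * m.
Proof.
move=> m0 am; have X0 j : 0 <= \sum_(0 <= n < N) hilbert_kernel gamma j.+1 n.+1 * modulus (a n).
  by apply: sumr_ge0 => n _; rewrite mulr_ge0 ?hilbert_kernel_ge0 ?modulus_ge0.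
rewrite leNgt; apply/negP => h.
have : (C * m) `^ p < (\sum_(0 <= n < N) hilbert_kernel gamma k.+1 n.+1 * modulus (a n)) `^ p.
  by rewrite gt0_ltr_powR ?nnegrE// mulr_ge0// ltW.
rewrite ltNge => /negP; apply.
have := @hilbert_schur _ p gamma (modulus \o a) k.+1 N p1 hs (fun n => modulus_ge0 (a n)).
rewrite big_nat_recr//= -/C => H; rewrite powRM ?(ltW C0)//.
apply: (@le_trans _ _ (C `^ p * \sum_(0 <= n < N) modulus (a n) `^ p)).
  by apply: le_trans H; rewrite lerDr sumr_ge0// => j _; exact: powR_ge0.
by rewrite ler_wpM2l ?powR_ge0//; exact: lpnorm_sum_le am.
Qed.

Lemma hilbert_op_cvg g a k : in_lp p a ->
  modulus (hilbert_op g gamma a k - series (hilbert_term g a k) N) @[N --> \oo] --> (0 : R).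
Proof.
move=> /in_lpP[m m0 am].
have /cvg_complex_series[l hl] N :
    \sum_(0 <= n < N) modulus (hilbert_term g a k n) <= modulus (g k) * (C * m).
  under eq_bigr do rewrite modulus_hilbert_term.
  by rewrite -mulr_sumr ler_wpM2l ?modulus_ge0//; exact: hilbert_row_le.
by rewrite hilbert_opE (lim_complex hl).
Qed.

Lemma hilbert_op_linear g : linear_on_lp p (hilbert_op g gamma).
Proof.
move=> c a b ha hb; apply/funext => k.
rewrite {1}hilbert_opE; apply: lim_complex; apply/cvgn_complexP.
have -> : series (hilbert_term g (fun n => c * a n + b n) k) =
    (fun N => c * series (hilbert_term g a k) N + series (hilbert_term g b k) N).
  apply/funext => N; rewrite /series /= mulr_sumr -big_split /=.
  by apply: eq_bigr => n _; rewrite /hilbert_term; ring.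
apply: (@cvgD _ (R[i] : numFieldType)).
  apply: (@cvgM (R[i] : numFieldType)); first exact: cvg_cst.
  by apply/cvgn_complexP; exact: hilbert_op_cvg.
by apply/cvgn_complexP; exact: hilbert_op_cvg.
Qed.

(** Boundedness of the operator with norm at most Q, expressed on finite sections and nonnegative
    sequences. The weights enter as |g_k|^p, one per row, so bounds for disjoint sets of rows add
    up. *)
Definition weighted_schur g (Q : R) := forall b K N, (forall n, 0 <= b n) ->
  \sum_(0 <= k < K) modulus (g k) `^ p *
    (\sum_(0 <= n < N) hilbert_kernel gamma k.+1 n.+1 * b n) `^ p <=
  Q `^ p * \sum_(0 <= n < N) b n `^ p.

Lemma hilbert_op_le g Q a : 0 <= Q -> weighted_schur g Q -> in_lp p a ->
  (lpnorm p (hilbert_op g gamma a) <= Q%:E * lpnorm p a)%E.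
Proof.
move=> Q0 hQ ha; have /in_lpP[m m0 am] := ha.
rewrite am -EFinM; apply/(lpnorm_leP _ p0 (mulr_ge0 Q0 m0)) => K.
apply: (modulus_lim_sum_le (z := fun N k => series (hilbert_term g a k) N)) => // [k|N].
  exact: hilbert_op_cvg.
rewrite powRM//.
apply: (@le_trans _ _ (Q `^ p * \sum_(0 <= n < N) modulus (a n) `^ p)); last first.
  by rewrite ler_wpM2l ?powR_ge0//; exact: lpnorm_sum_le am.
apply: le_trans (hQ (modulus \o a) K N (fun n => modulus_ge0 _)).
apply: ler_sum => k _; rewrite -powRM ?modulus_ge0//; last first.
  by apply: sumr_ge0 => n _; rewrite mulr_ge0 ?hilbert_kernel_ge0 ?modulus_ge0.
apply: ler_powRl; [exact: ltW|exact: modulus_ge0|].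
rewrite mulr_sumr /series /=.
elim: N => [|N IH]; first by rewrite !big_geq// modulus0.
rewrite !big_nat_recr//=; apply: (le_trans (modulusD _ _)).
by apply: lerD => //; rewrite modulus_hilbert_term.
Qed.

Lemma hilbert_op_bounded g Q : 0 <= Q -> weighted_schur g Q ->
  bounded_op p (hilbert_op g gamma).
Proof.
move=> Q0 hQ; split; first exact: hilbert_op_linear.
by exists Q => a ha; exact: hilbert_op_le.
Qed.

Lemma weighted_schur_sup g W : 0 <= W -> (forall k, modulus (g k) `^ p <= W) ->
  weighted_schur g (W `^ p^-1 * C).
Proof.
move=> W0 hW b K N b0.
have -> : (W `^ p^-1 * C) `^ p = W * C `^ p.
  by rewrite powRM ?powR_ge0 ?(ltW C0)// -powRrM mulVf ?gt_eqF// powRr1.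
rewrite -mulrA; apply: le_trans (ler_wpM2l W0 (hilbert_schur K N p1 hs b0)).
by rewrite mulr_sumr; apply: ler_sum => k _; rewrite ler_wpM2r ?powR_ge0.
Qed.

Lemma hilbert_op_finite g a M k : (forall n, (M <= n)%N -> a n = 0) ->
  hilbert_op g gamma a k = series (hilbert_term g a k) M.
Proof.
move=> aM; rewrite hilbert_opE; apply: lim_complex.
apply: cvg_near_cst; near=> N.
have MN : (M <= N)%N by near: N; exact: nbhs_infty_ge.
have -> : series (hilbert_term g a k) N = series (hilbert_term g a k) M.
  rewrite /series /= [LHS](@big_cat_nat _ _ _ M 0 N)//= [X in _ + X]big_nat_cond.
  rewrite [X in _ + X]big1 ?addr0// => n /andP[/andP[Mn _] _].
  by rewrite /hilbert_term aM// !mulr0.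
by rewrite subrr modulus0.
Unshelve. all: by end_near. Qed.

End HilbertOperator.

(** * Operators with finitely many nonzero rows are compact *)

Section FiniteRank.
Context {R : realType}.
Implicit Types (p : R) (T S : (nat -> R[i]) -> (nat -> R[i])).

Lemma increasing_homo (phi : nat -> nat) : increasing_seq phi ->
  {homo phi : i j / (i < j)%N}.
Proof. by move=> h i j ij; have := @leW_mono _ _ _ _ _ h i j; rewrite !ltEnat /= => ->. Qed.

Lemma complex_bolzano_weierstrass (K : nat) (u : nat -> nat -> R[i]) (B : R) :
  (forall j k, modulus (u j k) <= B) ->
  exists (phi : nat -> nat) (b : nat -> R[i]), {homo phi : i j / (i < j)%N} /\
    forall k, (k < K)%N -> modulus (u (phi j) k - b k) @[j --> \oo] --> (0 : R).
Proof.
move=> uB; elim: K => [|K [phi [b [hphi hb]]]].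
  by exists id, (fun=> 0); split.
have bnd (f : nat -> R) : (forall n, `|f n| <= B) -> bounded_fun f.
  move=> fB; exists B; split; first exact: num_real.
  by move=> x Bx n _ /=; apply: (le_trans (fB n)); exact: ltW.
have [f1 /increasing_homo f1i c1] := bolzano_weierstrass (bnd (fun j => complex.Re (u (phi j) K))
  (fun j => le_trans (Re_le_modulus _) (uB _ _))).
have [f2 /increasing_homo f2i c2] := bolzano_weierstrass (bnd (fun j => complex.Im (u (phi (f1 j)) K))
  (fun j => le_trans (Im_le_modulus _) (uB _ _))).
have sub (f : nat -> nat) : {homo f : i j / (i < j)%N} -> f j @[j --> \oo] --> \oo.
  move=> fi; have fge n : (n <= f n)%N.
    by elim: n => // n IH; apply: leq_ltn_trans IH _; exact: fi.
  by apply/cvgnyPge => A; near=> n; apply: leq_trans (fge n); near: n; exact: nbhs_infty_ge.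
set x := limn _ in c1; set y := limn _ in c2.
exists (phi \o f1 \o f2), (fun k => if k == K then x +i* y else b k); split.
  by move=> i j ij /=; apply/hphi/f1i/f2i.
move=> k; rewrite ltnS leq_eqVlt => /predU1P[->|kK].
  rewrite eqxx; apply/cvgr0Pnorm_lt => e e0; have e2 : 0 < e / 2 by rewrite divr_gt0.
  have c1' := cvg_comp _ _ (sub _ f2i) c1.
  move: c1' => /cvgrPdist_lt/(_ _ e2) h1; move: c2 => /cvgrPdist_lt/(_ _ e2) h2.
  near=> N.
  have g1 : `|x - complex.Re (u (phi (f1 (f2 N))) K)| < e / 2 by near: N.
  have g2 : `|y - complex.Im (u (phi (f1 (f2 N))) K)| < e / 2 by near: N.
  rewrite ger0_norm ?modulus_ge0// [e]splitr.
  apply: (le_lt_trans (modulus_le_Re_Im _)).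
  rewrite [in X in _ < X]addrC addrC.
  rewrite distrC in g1; rewrite distrC in g2.
  move: g1 g2 => /=; case: (u _ _) => v w /= g1 g2; exact: ltrD.
rewrite (ltn_eqF kK).
exact: (cvg_comp _ _ (cvg_comp _ _ (sub _ f2i) (sub _ f1i)) (hb k kK)).
Unshelve. all: by end_near. Qed.

Lemma finite_rank_compact p T K (Q : R) : 1 < p -> 0 <= Q -> linear_on_lp p T ->
  (forall a, in_lp p a -> (lpnorm p (T a) <= Q%:E * lpnorm p a)%E) ->
  (forall a k, (K <= k)%N -> T a k = 0) -> compact_op p T.
Proof.
move=> p1 Q0 Tlin TQ TK; have p0 : 0 < p by exact: lt_trans p1.
have inT a : in_lp p a -> in_lp p (T a).
  move=> ha; apply: (le_lt_trans (TQ a ha)).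
  by have /in_lpP[m m0 ->] := ha; rewrite -EFinM ltry.
split=> // x M xM.
have xin j : in_lp p (x j) by apply: (le_lt_trans (xM j)); exact: ltry.
have TB j k : modulus (T (x j) k) <= Q * `|M|.
  have M0 : 0 <= `|M| by [].
  have : (lpnorm p (T (x j)) <= (Q * `|M|)%:E)%E.
    apply: (le_trans (TQ _ (xin j))); rewrite EFinM lee_wpmul2l ?lee_fin//.
    by apply: (le_trans (xM j)); rewrite lee_fin ler_norm.
  move=> /(lpnorm_leP _ p0 (mulr_ge0 Q0 M0))/(_ k.+1); rewrite big_nat_recr//= => h.
  rewrite leNgt; apply/negP => hk.
  have : (Q * `|M|) `^ p < modulus (T (x j) k) `^ p.
    by rewrite gt0_ltr_powR ?nnegrE ?mulr_ge0 ?modulus_ge0.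
  rewrite ltNge => /negP; apply; apply: le_trans h.
  by rewrite lerDr sumr_ge0// => i _; exact: powR_ge0.
have [phi [b [hphi hb]]] := complex_bolzano_weierstrass K TB.
(* The extracted limit is controlled only below K, hence the cut. In [sumK] the per-coordinate
   radius makes K p-th powers add up to at most e^p; K + 1 also covers K = 0. *)
pose b' k := if (k < K)%N then b k else 0.
have sumK (z : nat -> R[i]) (e : R) : 0 <= e -> (forall k, (K <= k)%N -> z k = 0) ->
    (forall k, (k < K)%N -> modulus (z k) <= e / K.+1%:R `^ p^-1) ->
    (lpnorm p z <= e%:E)%E.
  move=> e0 z0 ze; apply/(lpnorm_leP _ p0 e0) => N.
  have KK : 0 < K.+1%:R `^ p^-1 :> R by rewrite powR_gt0.
  apply: (@le_trans _ _ (\sum_(0 <= k < K) e `^ p / K.+1%:R)).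
    apply: (@le_trans _ _ (\sum_(0 <= k < K) modulus (z k) `^ p)).
      have zp k : (K <= k)%N -> modulus (z k) `^ p = 0.
        by move=> /z0 ->; rewrite modulus0 powR0// gt_eqF.
      have [NK|/ltnW KN] := leqP N K.
        rewrite [leRHS](@big_cat_nat _ _ _ N)//= lerDl sumr_ge0// => k _; exact: powR_ge0.
      rewrite [leLHS](@big_cat_nat _ _ _ K)//= gerDl big_nat_cond big1//.
      by move=> k /andP[/andP[Kk _] _]; exact: zp.
    apply: ler_sum_nat => k /andP[_ kK].
    have -> : e `^ p / K.+1%:R = (e / K.+1%:R `^ p^-1) `^ p.
      rewrite powRM ?invr_ge0 ?(ltW KK)// powR_invl ?(ltW KK)// -powRrM mulrN mulVf ?gt_eqF//.
      by rewrite powR_inv1.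
    by apply: ler_powRl (ltW p0) (modulus_ge0 _) (ze _ kK).
  rewrite sumr_const_nat subn0 -[leLHS]mulr_natr -mulrA ler_piMr ?powR_ge0//.
  by rewrite mulrC ler_pdivrMr// mul1r ler_nat.
have cv (e : R) : 0 < e -> \forall j \near \oo, (lpnorm p (T (x (phi j)) \- b')%R <= e%:E)%E.
  move=> e0.
  have e1 : 0 < e / K.+1%:R `^ p^-1 by rewrite divr_gt0// powR_gt0.
  have H : \forall j \near \oo, forall k, (k < K)%N ->
      modulus (T (x (phi j)) k - b k) <= e / K.+1%:R `^ p^-1.
    have : forall K', (K' <= K)%N -> \forall j \near \oo, forall k, (k < K')%N ->
      modulus (T (x (phi j)) k - b k) <= e / K.+1%:R `^ p^-1.
      elim=> [|K' IH] KK; first by apply: nearW.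
      move: (hb K' KK) => /cvgr0Pnorm_le/(_ _ e1) h.
      have {}IH := IH (ltnW KK).
      near=> j => k; rewrite ltnS leq_eqVlt => /predU1P[->|].
        by apply: (le_trans (ler_norm _)); near: j.
      move: k; near: j; exact: IH.
    exact.
  apply: filterS H => j H; apply: sumK; first exact: ltW.
    by move=> k Kk /=; rewrite TK// /b' ltnNge Kk subrr.
  by move=> k kK /=; rewrite /b' kK; exact: H.
have b'in : in_lp p b'.
  have [j hj] := @filter_ex _ _ _ _ (cv 1 ltr01).
  have -> : b' = (fun k => T (x (phi j)) k + (- (T (x (phi j)) k - b' k))).
    by apply/funext => k; ring.
  apply: in_lpD; [exact: ltW|exact/inT/xin|].
  by rewrite /in_lp lpnormN (le_lt_trans hj)// ltry.
exists phi, b'; split => //.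
exact/(cvg_lpnorm0P p (fun j => T (x (phi j)) \- b')).
Unshelve. all: by end_near. Qed.

End FiniteRank.

(** * Lower bounds for essential norms *)

Section EssentialNormLower.
Context {R : realType}.
Implicit Types (p : R) (a b : nat -> R[i]).

Lemma linear_on_lp0 p (T : (nat -> R[i]) -> (nat -> R[i])) : 0 < p -> linear_on_lp p T ->
  T (fun=> 0) = (fun=> 0).
Proof.
move=> p0 Tl; have h0 := in_lp0 (R := R) p0; have := Tl 1 _ _ h0 h0.
have -> : (fun=> 1 * 0 + 0) = (fun=> 0) :> (nat -> R[i]).
  by apply/funext => n; rewrite mulr0 addr0.
move=> E; apply/funext => n; move/(congr1 (fun f => f n)): E => /eqP.
by rewrite mul1r -subr_eq0 opprD addrA subrr sub0r oppr_eq0 => /eqP.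
Qed.

Lemma in_lp_sum p J (x : nat -> nat -> R[i]) : 1 <= p -> (forall j, in_lp p (x j)) ->
  in_lp p (fun n => \sum_(0 <= j < J) x j n).
Proof.
move=> p1 xin; have p0 : 0 < p by exact: lt_le_trans p1.
elim: J => [|J IH].
  by under eq_fun do rewrite big_geq//; exact: in_lp0.
by under eq_fun do rewrite big_nat_recr//=; exact: in_lpD.
Qed.

Lemma linear_on_lp_sum p (T : (nat -> R[i]) -> (nat -> R[i])) J (c : R[i])
    (x : nat -> nat -> R[i]) : 1 <= p -> linear_on_lp p T -> (forall j, in_lp p (x j)) ->
  T (fun n => c * \sum_(0 <= j < J) x j n) = (fun n => c * \sum_(0 <= j < J) T (x j) n).
Proof.
move=> p1 Tl xin; have p0 : 0 < p by exact: lt_le_trans p1.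
have sumT : T (fun n => \sum_(0 <= j < J) x j n) = (fun n => \sum_(0 <= j < J) T (x j) n).
  elim: J => [|J IH].
    under eq_fun do rewrite big_geq//; rewrite (linear_on_lp0 p0)//.
    by apply/funext => n; rewrite big_geq.
  have -> : (fun n => \sum_(0 <= j < J.+1) x j n) =
      (fun n => 1 * x J n + \sum_(0 <= j < J) x j n).
    by apply/funext => n; rewrite big_nat_recr//= addrC mul1r.
  rewrite Tl//; last exact: in_lp_sum.
  by apply/funext => n; rewrite IH big_nat_recr//= addrC mul1r.
have -> : (fun n => c * \sum_(0 <= j < J) x j n) =
    (fun n => c * \sum_(0 <= j < J) x j n + 0).
  by apply/funext => n; rewrite addr0.
rewrite Tl ?(linear_on_lp0 p0)//; [|exact: in_lp_sum|exact: in_lp0].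
by apply/funext => n; rewrite sumT addr0.
Qed.

Lemma modulus_sum_disjoint p J (x : nat -> nat -> R[i]) n : 0 < p ->
  (forall i j, (i < j < J)%N -> x i n = 0 \/ x j n = 0) ->
  modulus (\sum_(0 <= j < J) x j n) `^ p = \sum_(0 <= j < J) modulus (x j n) `^ p.
Proof.
move=> p0; elim: J => [|J IH] dis.
  by rewrite !big_geq// modulus0 powR0// gt_eqF.
rewrite !big_nat_recr//= -IH; last first.
  by move=> i j /andP[ij jJ]; apply: dis; rewrite ij ltnW.
have [xJ|xJ] := eqVneq (x J n) 0.
  by rewrite xJ addr0 modulus0 powR0 ?gt_eqF// addr0.
have -> : \sum_(0 <= j < J) x j n = 0.
  rewrite big_nat_cond big1// => j /andP[/andP[_ jJ] _].
  by have [|//|/eqP] := dis j J; rewrite ?jJ ?leqnn// (negbTE xJ).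
by rewrite add0r modulus0 powR0 ?gt_eqF// add0r.
Qed.

Lemma lpnorm_sum_disjoint p J (x : nat -> nat -> R[i]) : 0 < p ->
  (forall i j n, (i < j)%N -> x i n = 0 \/ x j n = 0) ->
  (forall j, (lpnorm p (x j) <= 1)%E) ->
  (lpnorm p (fun n => (\sum_(0 <= j < J) x j n)%R) <= (J%:R `^ p^-1)%:E)%E.
Proof.
move=> p0 dis x1; apply/(lpnorm_leP _ p0 (powR_ge0 _ _)) => N.
rewrite -powRrM mulVf ?gt_eqF// powRr1//.
under eq_bigr => n _ do rewrite (modulus_sum_disjoint p0 (fun i j ij => dis i j n (proj1 (andP ij)))).
rewrite exchange_big_nat /=.
apply: (@le_trans _ _ (\sum_(0 <= j < J) 1)); last by rewrite sumr_const_nat subn0.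
apply: ler_sum => j _.
by have := (lpnorm_leP (x j) p0 ler01).1 (x1 j) N; rewrite powR1.
Qed.

(* A weakly null sequence would be sent by T to a null sequence; for disjointly
   supported x_j this is elementary: if T x_j tends to b with b nonzero, then
   J^(-1/p) \sum_(j < J) x_j is bounded in l^p, while the norm of its image
   grows like J^(1 - 1/p). *)
Lemma essnorm_ge p (S : (nat -> R[i]) -> (nat -> R[i])) (theta : R) : 1 < p ->
  (forall N0, exists x M, [/\ forall n, ~~ (N0 <= n < M)%N -> x n = 0,
     (lpnorm p x <= 1)%E & (theta%:E <= lpnorm p (S x))%E]) ->
  (theta%:E <= essnorm p S)%E.
Proof.
move=> p1 H; have p0 : 0 < p by exact: lt_trans p1.
have p1' := ltW p1.
apply: le_ereal_inf_tmp => _ [T [Tl Tin Tc] <-].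
rewrite leNgt; apply/negP => hm.
have m0 : (0 <= opnorm p (fun a => (S a \- T a)%R))%E.
  apply: le_trans (lpnorm_le_opnorm _ (a := fun=> 0) _); first exact: lpnorm_ge0.
  by rewrite lpnorm0// lee_fin.
have [m Em] : exists m, opnorm p (fun a => (S a \- T a)%R) = m%:E.
  by move: hm m0; case: (opnorm _ _) => [r| |]// _ _; exists r.
(* Since the difference S - T has norm m on the unit ball, del bounds the norm of every T x_j from
   below. *)
rewrite Em lte_fin in hm; pose del := theta - m.
have del0 : 0 < del by rewrite subr_gt0.
have /choice[f hf] : forall N0, exists xM : (nat -> R[i]) * nat,
    [/\ forall n, ~~ (N0 <= n < xM.2)%N -> xM.1 n = 0,
     (lpnorm p xM.1 <= 1)%E & (theta%:E <= lpnorm p (S xM.1))%E].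
  by move=> N0; have [x [M [h1 h2 h3]]] := H N0; exists (x, M).
(* Each support starts after the end of the preceding one. The maximum keeps the starts monotone, as
   nothing relates a start to the end returned for it. *)
pose Nj := fix Nj j := if j is j'.+1 then maxn (Nj j') (f (Nj j')).2 else 0%N.
pose x j := (f (Nj j)).1.
have Nmono i j : (i <= j)%N -> (Nj i <= Nj j)%N.
  by apply: (homo_leq leqnn leq_trans) => k /=; exact: leq_maxl.
have xdis i j n : (i < j)%N -> x i n = 0 \/ x j n = 0.
  move=> ij; have [h1 _ _] := hf (Nj i); have [h2 _ _] := hf (Nj j).
  have [nj|nj] := ltnP n (Nj j); first by right; apply: h2; rewrite leqNgt nj.
  left; apply: h1; rewrite negb_and -leqNgt; apply/orP; right.
  by apply: leq_trans nj; apply: leq_trans (Nmono _ _ ij); exact: leq_maxr.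
have x1 j : (lpnorm p (x j) <= 1)%E by have [] := hf (Nj j).
have xin j : in_lp p (x j) by apply: (le_lt_trans (x1 j)); exact: ltry.
have Txdel j : (del%:E <= lpnorm p (T (x j)))%E.
  have [_ _ h3] := hf (Nj j); rewrite -/(x j) in h3.
  have h4 := lpnorm_le_opnorm (fun a => (S a \- T a)%R) (x1 j); rewrite Em /= in h4.
  have [t t0 Et] := in_lpP (Tin _ (xin j)).
  rewrite /del EFinB leeBlDr//; apply: (le_trans h3).
  have -> : S (x j) = (fun n => T (x j) n + (S (x j) \- T (x j)) n).
    by apply/funext => n /=; ring.
  by apply: (le_trans (lpnormD _ _ p1')); rewrite leeD2l.
clearbody del.
have [phi [b [phii bin cv]]] := Tc x 1 x1.
have [beta beta0 Eb] := in_lpP bin.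
(* With T y_j within del/4 of b, the norm of b is at least 3 del/4, and a sum of J images stays
   within J del/4 of J b. Its norm is thus at least J del/2. *)
have d4 : 0 < del / 4 by rewrite divr_gt0.
have [J0 _ hJ0] := (cvg_lpnorm0P p (fun j => T (x (phi j)) \- b)).1 cv _ d4.
pose y j := x (phi (J0 + j)%N).
have ydis i j n : (i < j)%N -> y i n = 0 \/ y j n = 0.
  by move=> ij; apply/xdis/phii; rewrite ltn_add2l.
have yb j : (lpnorm p (T (y j) \- b)%R <= (del / 4)%:E)%E by apply: hJ0 => /=; exact: leq_addr.
have Tyin j : in_lp p (T (y j)) by apply/Tin/xin.
have betadel : del - del / 4 <= beta.
  rewrite lerBlDr -lee_fin EFinD -Eb; apply: (le_trans (Txdel (phi (J0 + 0)%N))).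
  rewrite -/(y 0%N).
  have -> : T (y 0%N) = (fun n => b n + (T (y 0%N) \- b) n).
    by apply/funext => n /=; ring.
  by apply: (le_trans (lpnormD _ _ p1')); rewrite leeD2l// yb.
have sumb J : (lpnorm p (fun n => (\sum_(0 <= j < J) (T (y j) n - b n))%R) <= (J%:R * (del / 4))%:E)%E.
  elim: J => [|J IH].
    by under [X in lpnorm p X]eq_fun do rewrite big_geq//; rewrite lpnorm0// mul0r.
  under [X in lpnorm p X]eq_fun do rewrite big_nat_recr//=.
  apply: (le_trans (lpnormD _ _ p1')).
  by rewrite natS mulrDl mul1r EFinD; apply: leeD => //; exact: yb.
have sumT J : (((J%:R * (del / 2))%:E <= lpnorm p (fun n => (\sum_(0 <= j < J) T (y j) n)%R)))%E.
  have sin : in_lp p (fun n => (\sum_(0 <= j < J) T (y j) n)%R) by exact: in_lp_sum.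
  have [s s0 Es] := in_lpP sin; rewrite Es lee_fin.
  have : (lpnorm p (fun n => (J%:R * b n)%R) <= (s + J%:R * (del / 4))%:E)%E.
    have -> : (fun n => J%:R * b n) = (fun n => \sum_(0 <= j < J) T (y j) n +
        - (\sum_(0 <= j < J) (T (y j) n - b n))).
      apply/funext => n; rewrite sumrB opprB addrCA subrr addr0 sumr_const_nat subn0.
      by rewrite mulr_natl.
    by apply: (le_trans (lpnormD _ _ p1')); rewrite Es lpnormN EFinD leeD2l.
  have : ((J%:R * beta)%:E <= lpnorm p (fun n => (J%:R * b n)%R))%E.
    have [z z0 Ez] := in_lpP (in_lpZ J%:R p0 bin); rewrite Ez lee_fin.
    have [->|J0'] := eqVneq J 0%N; first by rewrite mul0r.
    have Jp : (0 : R) < J%:R by rewrite ltr0n lt0n.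
    have hz : (lpnorm p (fun n => (J%:R * b n)%R) <= z%:E)%E by rewrite Ez.
    have := lpnormZ (J%:R^-1)%:C p0 z0 hz.
    rewrite modulus_real ger0_norm ?invr_ge0//.
    have -> : (fun n => (J%:R^-1)%:C * (J%:R * b n)) = b.
      apply/funext => n; rewrite fmorphV /= rmorph_nat mulrA mulVf ?mul1r//.
      by rewrite pnatr_eq0.
    by rewrite Eb lee_fin ler_pdivlMl.
  move=> h1 h2; have := le_trans h1 h2; rewrite lee_fin => h3.
  have : J%:R * (del - del / 4) <= J%:R * beta by rewrite ler_wpM2l.
  have : J%:R * (del - del / 4) = J%:R * (del / 2) + J%:R * (del / 4) by field.
  lra.
(* Disjoint supports give these combinations norm at most 1; starting at J + 1 terms avoids a
   negative power of 0. *)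
pose z J := (fun n => ((J.+1%:R `^ (- p^-1))%:C * \sum_(0 <= j < J.+1) y j n)%R).
have z1 J : (lpnorm p (z J) <= 1%:E)%E.
  have := lpnormZ (J.+1%:R `^ (- p^-1))%:C p0 (powR_ge0 _ _)
     (lpnorm_sum_disjoint J.+1 p0 ydis (fun j => x1 _)).
  rewrite modulus_real ger0_norm ?powR_ge0// -powRD ?addNr ?powRr0//.
  by rewrite eqxx pnatr_eq0.
have Tz J : ((J.+1%:R `^ (1 - p^-1) * (del / 2))%:E <= lpnorm p (T (z J)))%E.
  rewrite (linear_on_lp_sum J.+1 _ p1' Tl (fun j => xin _)).
  have sin : in_lp p (fun n => (\sum_(0 <= j < J.+1) T (y j) n)%R) by exact: in_lp_sum.
  have [s s0 Es] := in_lpP (in_lpZ (J.+1%:R `^ (- p^-1))%:C p0 sin).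
  rewrite Es lee_fin.
  have hs := lpnormZ (J.+1%:R `^ p^-1)%:C p0 s0 (eq_ind_r (fun x => (x <= s%:E)%E) (lexx _) Es).
  move: hs; rewrite modulus_real ger0_norm ?powR_ge0//.
  have JJ : J.+1%:R `^ p^-1 * J.+1%:R `^ (- p^-1) = 1 :> R.
    by rewrite -powRD ?subrr ?powRr0// eqxx pnatr_eq0.
  have -> : (fun n => (J.+1%:R `^ p^-1)%:C * ((J.+1%:R `^ (- p^-1))%:C *
       \sum_(0 <= j < J.+1) T (y j) n)) = (fun n => \sum_(0 <= j < J.+1) T (y j) n).
    by apply/funext => n; rewrite mulrA -rmorphM /= JJ mul1r.
  move=> h; have := le_trans (sumT J.+1) h; rewrite lee_fin => h2.
  have pp : 0 < J.+1%:R `^ p^-1 :> R by rewrite powR_gt0.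
  have JE : J.+1%:R `^ p^-1 * J.+1%:R `^ (1 - p^-1) = J.+1%:R :> R.
    by rewrite -powRD ?pnatr_eq0 ?implybT// addrCA subrr addr0 powRr1.
  by rewrite -(ler_pM2l pp) [leLHS]mulrA JE.
(* Compactness is applied a second time: a convergent subsequence of the T z_J is bounded, against
   their growth. *)
have [psi [c [psii cin cv2]]] := Tc z 1 z1.
have [kap kap0 Ek] := in_lpP cin.
have [J1 _ hJ1] := (cvg_lpnorm0P p (fun j => T (z (psi j)) \- c)).1 cv2 _ ltr01.
have psige n : (n <= psi n)%N.
  by elim: n => // n IH; apply: leq_ltn_trans IH _; exact: psii.
have e0 : 0 < (kap + 1) + 1 by lra.
have q0 : 0 < 1 - p^-1 by rewrite subr_gt0 invf_lt1.
have ee : 0 < del / 2 / (kap + 1 + 1) by rewrite !divr_gt0.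
have [r0 [r0p hr]] := powR_small 1 q0 ee.
pose j := maxn J1 r0.
have h1 : (lpnorm p (T (z (psi j)) \- c)%R <= 1%:E)%E by apply: hJ1 => /=; exact: leq_maxl.
have h2 := Tz (psi j).
have h3 : (lpnorm p (T (z (psi j))) <= (kap + 1)%:E)%E.
  have -> : T (z (psi j)) = (fun n => c n + (T (z (psi j)) \- c) n).
    by apply/funext => n /=; ring.
  by apply: (le_trans (lpnormD _ _ p1')); rewrite Ek EFinD leeD2l.
have := le_trans h2 h3; rewrite lee_fin.
have jr : r0%:R <= (psi j).+1%:R :> R.
  by rewrite ler_nat (leq_trans (leq_maxr J1 r0))// (leq_trans (psige j)).
have := hr _ jr; rewrite mul1r powRN ler_pdivlMr// mulrC.
rewrite ler_pdivrMr ?powR_gt0// => h4 h5.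
have : kap + 1 + 1 <= kap + 1.
  by apply: (le_trans h4); rewrite mulrC.
by rewrite gerDl ler10.
Qed.

End EssentialNormLower.

(** * Block means and essential norms *)

Section HilbertEssentialNorm.
Context {R : realType}.
Context (p gamma : R) (p1 : 1 < p) (hs : 0 < p^-1 + gamma < 1).
Implicit Types (g a : nat -> R[i]) (w X : nat -> R).

Let C := pi / sin (pi * (p^-1 + gamma)).

Let p0 : 0 < p. Proof. exact: lt_trans p1. Qed.
Let C0 : 0 < C. Proof. exact: csc_gt0. Qed.

Lemma big_nat_support w (N M K : nat) : (0 < N)%N -> (N <= M)%N -> (M <= K.+1)%N ->
  (forall k, ~~ (N <= k < M)%N -> w k = 0) ->
  \sum_(0 <= n < K) w n.+1 = \sum_(N <= k < M) w k.
Proof.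
move=> N0 NM MK w0; have -> : \sum_(0 <= n < K) w n.+1 = \sum_(1 <= k < K.+1) w k.
  by rewrite big_add1.
rewrite (@big_cat_nat _ _ _ N)//=; last exact: leq_trans NM MK.
rewrite [X in X + _]big_nat_cond big1 ?add0r; last first.
  by move=> k /andP[/andP[_ kN] _]; apply: w0; rewrite leqNgt kN.
rewrite (@big_cat_nat _ _ _ M)//= [X in _ + X]big_nat_cond [X in _ + X]big1 ?addr0//.
by move=> k /andP[/andP[Mk _] _]; apply: w0; rewrite negb_and -leqNgt Mk orbT.
Qed.

(** Only the harmonic averages of |g_k|^p over suitable intervals enter, so the same bound applies
    to convergent block means and to the sequence concentrated on half blocks. *)
Lemma hilbert_essnorm_ge g (Lam theta : R) :
  (forall A0, exists2 A, (A0 <= A)%N & forall B0, exists2 B, (B0 <= B)%N &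
     Lam * harmonic_sum A B <= \sum_(A <= k < B) modulus (g k.-1) `^ p / k%:R) ->
  0 <= theta -> 0 < Lam -> theta `^ p < C `^ p * Lam ->
  (theta%:E <= essnorm p (hilbert_op g gamma))%E.
Proof.
move=> dens th0 L0 thL; apply: essnorm_ge => // N0.
have [N [M [A [B [NN A0 AB NM H]]]]] :=
  hilbert_test_sequence p1 hs (fun k => powR_ge0 (modulus (g k.-1)) p) dens th0 L0 thL N0.
have N_gt0 : (0 < N)%N by exact: leq_ltn_trans NN.
set S := harmonic_sum N M in H.
have S0 : 0 < S.
  rewrite /S /harmonic_sum big_ltn// ltr_wpDr ?invr_gt0 ?ltr0n//.
  exact: harmonic_sum_ge0.
(* The p-th powers of n^(-1/p) over [N, M[ sum to S, so c normalises the test sequence. *)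
pose c := S `^ (- p^-1).
have cp : c `^ p = S^-1 by rewrite /c -powRrM mulNr mulVf ?gt_eqF// powR_inv1// ltW.
pose e (n : nat) : R := if (N <= n < M)%N then n%:R `^ (- p^-1) else 0.
have e0 n : 0 <= e n by rewrite /e; case: ifP => // _; exact: powR_ge0.
have c0 : 0 <= c by exact: powR_ge0.
exists (fun n => (c * e n.+1)%:C), M; split.
- move=> n; rewrite /e; case: ifP => [/andP[Nn nM] /negP[]|_ _]; last by rewrite mulr0.
  by rewrite (ltnW nM) andbT -ltnS (leq_trans NN Nn).
- apply/(lpnorm_leP _ p0 ler01) => K; rewrite powR1.
  have E n : modulus (c * e n.+1)%:C `^ p = S^-1 * e n.+1 `^ p.
    by rewrite modulus_real ger0_norm ?mulr_ge0// powRM// cp.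
  under eq_bigr do rewrite E.
  rewrite -mulr_sumr ler_pdivrMl// mulr1.
  apply: (@le_trans _ _ (\sum_(0 <= n < K + M) e n.+1 `^ p)).
    by rewrite [leRHS](@big_cat_nat _ _ _ K) ?leq_addr//= lerDl sumr_ge0// => *; exact: powR_ge0.
  rewrite (@big_nat_support (fun k => e k `^ p) N M)//; last 3 first.
  + exact: ltnW.
  + by rewrite (leq_trans (leq_addl K M)).
  + by move=> k kNM; rewrite /e (negbTE kNM) powR0// gt_eqF.
  apply: ler_sum_nat => k kNM; rewrite /e kNM -powRrM mulNr mulVf ?gt_eqF// powR_inv1//.
pose Y (k : nat) := \sum_(N <= n < M) hilbert_kernel gamma k n * n%:R `^ (- p^-1).
have Y0 k : 0 <= Y k by apply: sumr_ge0 => n _; rewrite mulr_ge0 ?hilbert_kernel_ge0 ?powR_ge0.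
have HY k : modulus (hilbert_op g gamma (fun n => (c * e n.+1)%:C) k) `^ p =
    modulus (g k) `^ p * (S^-1 * Y k.+1 `^ p).
  rewrite (hilbert_op_finite _ _ (M := M)); last first.
    move=> n Mn; rewrite /e ifF ?mulr0//; apply/negbTE.
    by rewrite negb_and -!leqNgt (leq_trans Mn) ?orbT.
  have -> : series (hilbert_term gamma g (fun n => (c * e n.+1)%:C) k) M =
      g k * (c * Y k.+1)%:C.
    have -> : Y k.+1 = \sum_(0 <= n < M) hilbert_kernel gamma k.+1 n.+1 * e n.+1.
      rewrite (@big_nat_support (fun n => hilbert_kernel gamma k.+1 n * e n) N M)//; last 2 first.
      + exact: ltnW.
      + by move=> n nNM; rewrite /e (negbTE nNM) mulr0.
      by apply: eq_big_nat => n nNM; rewrite /e nNM.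
    rewrite mulr_sumr rmorph_sum /= mulr_sumr /series /=; apply: eq_bigr => n _.
    by rewrite /hilbert_term !rmorphM /=; ring.
  rewrite modulusM modulus_real ger0_norm ?mulr_ge0// powRM ?modulus_ge0 ?mulr_ge0//.
  by rewrite (powRM _ c0)// cp.
(* Rows below B are the first B - 1 entries in the shifted numbering. *)
apply: (@lpnorm_geP _ _ _ B.-1) => //.
under eq_bigr do rewrite HY.
rewrite -(ler_pM2r S0); apply: (le_trans H).
have -> : \sum_(A <= k < B) modulus (g k.-1) `^ p * Y k `^ p =
    \sum_(A.-1 <= k < B.-1) modulus (g k) `^ p * Y k.+1 `^ p.
  by rewrite -[A in LHS](prednK A0) big_add1.
rewrite mulr_suml [leRHS](@big_cat_nat _ _ _ A.-1)//=; last by rewrite -!subn1 leq_sub2r.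
have -> : \sum_(A.-1 <= i < B.-1) modulus (g i) `^ p * (S^-1 * Y i.+1 `^ p) * S =
    \sum_(A.-1 <= i < B.-1) modulus (g i) `^ p * Y i.+1 `^ p.
  by apply: eq_bigr => k _; field; rewrite gt_eqF.
rewrite lerDr sumr_ge0// => k _.
by rewrite !mulr_ge0 ?powR_ge0 ?invr_ge0 ?ltW.
Qed.

Lemma eq_hilbert_op g g' a k : g k = g' k -> hilbert_op g gamma a k = hilbert_op g' gamma a k.
Proof.
by move=> gg; rewrite !hilbert_opE; congr (limn (series _ : nat -> (R[i] : numFieldType)));
   apply/funext => n; rewrite /hilbert_term gg.
Qed.

Lemma hilbert_op_eq0 g a k : g k = 0 -> hilbert_op g gamma a k = 0.
Proof.
move=> gk; rewrite hilbert_opE; apply: lim_complex.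
apply: cvg_near_cst; apply: nearW => N.
by rewrite /series /= big1 ?subrr ?modulus0// => n _; rewrite /hilbert_term gk mul0r mulr0.
Qed.

Definition head_seq (K : nat) g : nat -> R[i] := fun k => if (k < K)%N then g k else 0.
Definition tail_seq (K : nat) g : nat -> R[i] := fun k => if (k < K)%N then 0 else g k.

Lemma head_seq_le K g k :
  modulus (head_seq K g k) `^ p <= \sum_(0 <= j < K) modulus (g j) `^ p.
Proof.
rewrite /head_seq; case: ifP => kK.
  rewrite (@big_cat_nat _ _ _ k)//= ?(ltnW kK)// [\sum_(k <= _ < K) _]big_ltn//.
  by rewrite addrCA lerDl addr_ge0// sumr_ge0// => *; exact: powR_ge0.
by rewrite modulus0 powR0 ?gt_eqF// sumr_ge0// => *; exact: powR_ge0.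
Qed.

Lemma head_seq_compact K g : compact_op p (hilbert_op (head_seq K g) gamma).
Proof.
set W := \sum_(0 <= j < K) modulus (g j) `^ p.
have W0 : 0 <= W by apply: sumr_ge0 => *; exact: powR_ge0.
have Q0 : 0 <= W `^ p^-1 * C by rewrite mulr_ge0 ?powR_ge0 ?ltW.
apply: (finite_rank_compact (K := K) p1 Q0); first exact: hilbert_op_linear.
  move=> a ha; apply: hilbert_op_le => //.
  by apply: weighted_schur_sup => // k; exact: head_seq_le.
by move=> a k Kk; apply: hilbert_op_eq0; rewrite /head_seq ltnNge Kk.
Qed.

Lemma essnorm_le_tail K g Q : 0 <= Q -> weighted_schur p gamma (tail_seq K g) Q ->
  (essnorm p (hilbert_op g gamma) <= Q%:E)%E.
Proof.
move=> Q0 hQ; apply: (essnorm_le (head_seq_compact K g)) => a a1.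
have -> : hilbert_op g gamma a \- hilbert_op (head_seq K g) gamma a =
    hilbert_op (tail_seq K g) gamma a.
  apply/funext => k /=; have [kK|Kk] := ltnP k K.
    rewrite [hilbert_op (tail_seq _ _) _ _ _]hilbert_op_eq0 ?/tail_seq ?kK//.
    by rewrite (@eq_hilbert_op (head_seq K g) g) ?/head_seq ?kK// subrr.
  rewrite [hilbert_op (head_seq _ _) _ _ _]hilbert_op_eq0 ?/head_seq ?ltnNge ?Kk//.
  by rewrite subr0; apply: eq_hilbert_op; rewrite /tail_seq ltnNge Kk.
have ha : in_lp p a by apply: (le_lt_trans a1); exact: ltry.
apply: (le_trans (hilbert_op_le p1 hs Q0 hQ ha)).
by rewrite -[leRHS]mule1 lee_wpmul2l// lee_fin.
Qed.

(** Head and tail act on disjoint rows, so the p-th powers of their bounds add. This yields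
    boundedness of the full operator from an estimate that holds only far out. *)
Lemma weighted_schur_head_tail K g Q : weighted_schur p gamma (tail_seq K g) Q ->
  exists2 Q', 0 <= Q' & weighted_schur p gamma g Q'.
Proof.
move=> hQ; set W := \sum_(0 <= j < K) modulus (g j) `^ p.
have W0 : 0 <= W by apply: sumr_ge0 => *; exact: powR_ge0.
have hW := weighted_schur_sup p1 hs W0 (head_seq_le K g).
exists (((W `^ p^-1 * C) `^ p + Q `^ p) `^ p^-1) => [|b K' N b0]; first exact: powR_ge0.
rewrite -powRrM mulVf ?gt_eqF// powRr1 ?addr_ge0 ?powR_ge0// mulrDl.
apply: le_trans (lerD (hW b K' N b0) (hQ b K' N b0)).
rewrite -big_split /=; apply: ler_sum => k _; rewrite -mulrDl ler_wpM2r ?powR_ge0//.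
rewrite /head_seq /tail_seq; case: ifP => _; rewrite modulus0 powR0 ?gt_eqF//.
  by rewrite addr0.
by rewrite add0r.
Qed.

(** * Replacing weights by their block means *)

Section Blocks.
Context (d : nat -> nat) (hd0 : d 0%N = 1%N) (hd : {homo d : m n / (m < n)%N}).

Lemma ltn_block_bound n : (n < d n)%N.
Proof.
by elim: n => [|n IH]; [rewrite hd0|exact: leq_ltn_trans IH (hd (ltnSn n))].
Qed.

Lemma block_bound_mono m n : (m <= n)%N -> (d m <= d n)%N.
Proof. by rewrite leq_eqVlt => /predU1P[->//|/hd/ltnW]. Qed.

Lemma sum_blocks w (i j : nat) : (i <= j)%N ->
  \sum_(d i <= k < d j) w k = \sum_(i <= n < j) \sum_(d n <= k < d n.+1) w k.
Proof.
elim: j => [|j IH]; first by rewrite leqn0 => /eqP->; rewrite !big_geq.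
rewrite leq_eqVlt => /predU1P[<-|]; first by rewrite !big_geq.
rewrite ltnS => ij; rewrite big_nat_recr//= -IH//.
by rewrite (@big_cat_nat _ _ _ (d j)) ?block_bound_mono.
Qed.

Lemma block_mean_sum g n : ((d n.+1)%:R - (d n)%:R) * block_mean p d g n =
  \sum_(d n <= k < d n.+1) modulus (g k.-1) `^ p.
Proof.
rewrite /block_mean mulrA mulfV ?mul1r// subr_eq0 eqr_nat.
by rewrite gtn_eqF// hd.
Qed.

Lemma block_size_gt0 n : (0 : R) < (d n.+1)%:R - (d n)%:R.
Proof. by rewrite subr_gt0 ltr_nat hd. Qed.

Lemma block_mean_sum_le g X r n : (forall i j, (d n <= i < d n.+1)%N ->
    (d n <= j < d n.+1)%N -> X i <= r * X j) ->
  \sum_(d n <= k < d n.+1) modulus (g k.-1) `^ p * X k <=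
    block_mean p d g n * (r * \sum_(d n <= k < d n.+1) X k).
Proof.
move=> hX; rewrite -(ler_pM2l (block_size_gt0 n)).
apply: (le_trans (block_sum_le (r := r) (block_bound_mono (leqnSn n)) _ hX)).
  by move=> k; exact: powR_ge0.
by rewrite -block_mean_sum le_eqVlt; apply/orP; left; apply/eqP; ring.
Qed.

Lemma block_mean_sum_ge g X r n : (forall i j, (d n <= i < d n.+1)%N ->
    (d n <= j < d n.+1)%N -> X j <= r * X i) ->
  block_mean p d g n * (\sum_(d n <= k < d n.+1) X k) <=
    r * \sum_(d n <= k < d n.+1) modulus (g k.-1) `^ p * X k.
Proof.
move=> hX; rewrite -(ler_pM2l (block_size_gt0 n)) mulrA block_mean_sum.
apply: (le_trans (block_sum_ge (r := r) (block_bound_mono (leqnSn n)) _ hX)).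
  by move=> k; exact: powR_ge0.
by rewrite le_eqVlt; apply/orP; left; apply/eqP; ring.
Qed.

(** Unions of consecutive blocks inherit the blockwise bound by addition, and n < d n places them as
    far out and makes them as long as required. *)
Lemma block_density w (Lam : R) n0 :
  (forall n, (n0 <= n)%N -> Lam * harmonic_sum (d n) (d n.+1) <=
     \sum_(d n <= k < d n.+1) w k / k%:R) ->
  forall A0, exists2 A, (A0 <= A)%N & forall B0, exists2 B, (B0 <= B)%N &
    Lam * harmonic_sum A B <= \sum_(A <= k < B) w k / k%:R.
Proof.
move=> H A0; exists (d (maxn n0 A0)).
  by rewrite ltnW// (leq_ltn_trans _ (ltn_block_bound _))// leq_maxr.
move=> B0; set i := maxn n0 A0; exists (d (i + B0)%N).
  by rewrite ltnW// (leq_ltn_trans _ (ltn_block_bound _))// leq_addl.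
rewrite /harmonic_sum !sum_blocks ?leq_addr// mulr_sumr.
apply: ler_sum_nat => n /andP[jn _]; apply: H.
by rewrite (leq_trans _ jn)// leq_maxl.
Qed.

(** The cut [(d n0).-1] is index d n0 in the shifted numbering. Indices within a block differ by a
    factor at most r, kernel entries by r^2, and p-th powers of row sums by the p-th power of r^2,
    which is the only loss in replacing weights by L. *)
Lemma tail_schur g (L r : R) n0 : `|gamma| <= 1 -> 0 <= L -> 1 <= r ->
  (forall n, (n0 <= n)%N -> block_mean p d g n <= L) ->
  (forall n, (n0 <= n)%N -> (d n.+1)%:R <= r * (d n)%:R :> R) ->
  weighted_schur p gamma (tail_seq (d n0).-1 g) ((L * (r ^+ 2) `^ p) `^ p^-1 * C).
Proof.
move=> g1 L0 r1 hL hr b K N b0; have r0 : 0 <= r by exact: le_trans r1.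
pose Y k := (\sum_(0 <= n < N) hilbert_kernel gamma k n.+1 * b n) `^ p.
have Y0 k : 0 <= Y k by exact: powR_ge0.
(* The K given rows are enlarged to end at a block boundary. *)
pose n1 := (n0 + K)%N.
have dpos n : (0 < d n)%N by exact: leq_ltn_trans (ltn_block_bound n).
have Kn1 : (K <= (d n1).-1)%N.
  by rewrite -ltnS prednK// (leq_ltn_trans _ (ltn_block_bound _))// leq_addl.
rewrite powRM ?powR_ge0 ?(ltW C0)// -powRrM mulVf ?gt_eqF// powRr1 ?mulr_ge0 ?powR_ge0//.
rewrite -mulrA; apply: (@le_trans _ _ (L * (r ^+ 2) `^ p * \sum_(d n0 <= k < d n1) Y k)); last first.
  rewrite ler_wpM2l ?mulr_ge0 ?powR_ge0//.
  apply: le_trans (hilbert_schur (d n1).-1 N p1 hs b0).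
  rewrite -[d n0](prednK (dpos _)) big_add1 [leRHS](@big_cat_nat _ _ _ (d n0).-1)//=.
    by apply: ler_wpDl; [apply: sumr_ge0 => k _; exact: Y0|exact: lexx].
  by rewrite -!subn1 leq_sub2r// block_bound_mono// leq_addr.
apply: (@le_trans _ _ (\sum_(0 <= k < (d n1).-1) modulus (tail_seq (d n0).-1 g k) `^ p * Y k.+1)).
  by rewrite [leRHS](@big_cat_nat _ _ _ K)//= lerDl sumr_ge0// => k _; rewrite mulr_ge0 ?powR_ge0.
rewrite (@big_cat_nat _ _ _ (d n0).-1)//=; last by rewrite -!subn1 leq_sub2r// block_bound_mono// leq_addr.
rewrite [X in X + _]big_nat_cond big1 ?add0r; last first.
  move=> k /andP[/andP[_ kd] _]; rewrite /tail_seq kd modulus0 powR0 ?gt_eqF// mul0r//.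
have -> : \sum_((d n0).-1 <= k < (d n1).-1) modulus (tail_seq (d n0).-1 g k) `^ p * Y k.+1 =
   \sum_(d n0 <= k < d n1) modulus (g k.-1) `^ p * Y k.
  rewrite -[d n0 in RHS](prednK (dpos _)) big_add1; apply: eq_big_nat => k /andP[dk _].
  by rewrite /tail_seq ltnNge dk.
rewrite !sum_blocks ?leq_addr// mulr_sumr; apply: ler_sum_nat => n /andP[nn _].
have Ycmp i j : (d n <= i < d n.+1)%N -> (d n <= j < d n.+1)%N -> Y i <= (r ^+ 2) `^ p * Y j.
  move=> /andP[di iD] /andP[dj jD].
  have cmp (i' j' : nat) : (i' < d n.+1)%N -> (d n <= j')%N -> i'%:R <= r * j'%:R :> R.
    move=> h1 h2; apply: (@le_trans _ _ (d n.+1)%:R); first by rewrite ler_nat ltnW.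
    by apply: (le_trans (hr n nn)); rewrite ler_wpM2l// ler_nat.
  have X0 k : 0 <= \sum_(0 <= n < N) hilbert_kernel gamma k n.+1 * b n.
    by apply: sumr_ge0 => m _; rewrite mulr_ge0 ?hilbert_kernel_ge0.
  rewrite /Y -powRM ?exprn_ge0//; apply: ler_powRl => //; first exact: ltW.
  rewrite mulr_sumr; apply: ler_sum => m _; rewrite mulrA ler_wpM2r//.
  by apply: hilbert_kernel_comparable; rewrite // ?(leq_trans (dpos n))//; exact: cmp.
apply: (le_trans (block_mean_sum_le g Ycmp)).
by rewrite -[leRHS]mulrA ler_wpM2r ?hL// mulr_ge0 ?powR_ge0// sumr_ge0.
Qed.

End Blocks.
End HilbertEssentialNorm.

Section Conclusion.
Context {R : realType}.
Context (p gamma : R) (p1 : 1 < p) (hs : 0 < p^-1 + gamma < 1).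
Context (d : nat -> nat) (hd0 : d 0%N = 1%N) (hd : {homo d : m n / (m < n)%N}).
Implicit Types (g a : nat -> R[i]).

Let C := pi / sin (pi * (p^-1 + gamma)).

Let p0 : 0 < p. Proof. exact: lt_trans p1. Qed.
Let C0 : 0 < C. Proof. exact: csc_gt0. Qed.
Let dpos n : (0 < d n)%N. Proof. exact: leq_ltn_trans (ltn_block_bound hd0 hd n). Qed.

Lemma powR_div_mulK (x e : R) : 0 <= x -> 0 < e -> (x `^ e^-1) `^ e = x.
Proof. by move=> x0 e0; rewrite -powRrM mulVf ?gt_eqF// powRr1. Qed.

Lemma norm_gamma_le1 : `|gamma| <= 1.
Proof.
have : p^-1 <= 1 by rewrite invf_le1// ltW.
have : 0 < p^-1 by rewrite invr_gt0.
by case/andP: hs => h1 h2 h3 h4; rewrite ler_norml; apply/andP; split; lra.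
Qed.

Lemma block_mean_ge0 g n : 0 <= block_mean p d g n.
Proof.
rewrite /block_mean mulr_ge0 ?invr_ge0 ?(ltW (block_size_gt0 hd n))//.
by apply: sumr_ge0 => k _; exact: powR_ge0.
Qed.

Lemma block_ratio_le (r : R) : 1 < r -> (d k.+1)%:R / (d k)%:R @[k --> \oo] --> (1 : R) ->
  exists n0, forall n, (n0 <= n)%N -> (d n.+1)%:R <= r * (d n)%:R :> R.
Proof.
move=> r1 /cvgr_lt/(_ _ r1)[n0 _ H]; exists n0 => n nn.
by have /ltW := H n nn; rewrite ler_pdivrMr// ltr0n.
Qed.

(** * Block ratios tending to 1: the value of the essential norm *)

Section VanishingBlocks.
Context (g : nat -> R[i]) (L : R).
Context (ratio1 : (d k.+1)%:R / (d k)%:R @[k --> \oo] --> (1 : R)).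
Context (meanL : block_mean p d g n @[n --> \oo] --> L).

Lemma mean_limit_ge0 : 0 <= L.
Proof. by apply: (cvgr_to_ge meanL); apply: nearW => n; exact: block_mean_ge0. Qed.

Lemma tail_schur_near theta : C * L `^ p^-1 < theta ->
  exists K, weighted_schur p gamma (tail_seq K g) theta.
Proof.
move=> hth; have L0 := mean_limit_ge0.
have th0 : 0 < theta by apply: le_lt_trans hth; rewrite mulr_ge0 ?powR_ge0 ?ltW.
(* The mean that would give exactly theta. The gap between L and q is shared: L' bounds the block
   means eventually, and r is the root with r^(2p) = q / L', the distortion allowed within a
   block. *)
pose q := (theta / C) `^ p.
have tC0 : 0 < theta / C by rewrite divr_gt0.
have Lq : L < q.
  rewrite -(powR_div_mulK L0 p0) gt0_ltr_powR ?nnegrE ?powR_ge0 ?(ltW tC0)//.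
  by rewrite ltr_pdivlMr// mulrC.
pose L' := (L + q) / 2.
have L'L : L < L' by rewrite /L'; lra.
have L'q : L' < q by rewrite /L'; lra.
have L'0 : 0 < L' by exact: le_lt_trans L'L.
have qL : 1 < q / L' by rewrite ltr_pdivlMr// mul1r.
pose r := (q / L') `^ (p * 2)^-1.
have p2 : 0 < p * 2 by rewrite mulr_gt0.
have r1 : 1 < r.
  have {1}-> : 1 = 1 `^ (p * 2)^-1 :> R by rewrite powR1.
  by rewrite gt0_ltr_powR ?nnegrE ?invr_gt0// ltW// (lt_trans ltr01).
have [n1 hn1] := block_ratio_le r1 ratio1.
have [n2 _ hn2] := cvgr_lt _ meanL _ L'L.
pose n0 := maxn n1 n2.
have -> : theta = (L' * (r ^+ 2) `^ p) `^ p^-1 * C.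
  have -> : (r ^+ 2) `^ p = q / L'.
    have r0 : 0 <= r by rewrite powR_ge0.
    rewrite -(powR_mulrn 2 r0) -powRrM [2 * p]mulrC powR_div_mulK//.
    by rewrite ltW// (lt_trans ltr01).
  have -> : L' * (q / L') = q by rewrite mulrC divfK// gt_eqF.
  rewrite /q -powRrM mulfV ?gt_eqF// powRr1 ?(ltW tC0)//.
  by rewrite divfK// gt_eqF.
exists (d n0).-1; apply: (tail_schur p1 hs hd0 hd norm_gamma_le1 (ltW L'0) (ltW r1)).
  by move=> n nn; apply/ltW/hn2; rewrite /= (leq_trans _ nn)// leq_maxr.
by move=> n nn; apply: hn1; rewrite (leq_trans _ nn)// leq_maxl.
Qed.

Lemma hilbert_op_bounded_of_mean : bounded_op p (hilbert_op g gamma).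
Proof.
have [|K hK] := @tail_schur_near (C * L `^ p^-1 + 1); first by rewrite ltrDl.
have [Q Q0 hQ] := weighted_schur_head_tail p1 hs hK.
exact: (hilbert_op_bounded p1 hs Q0 hQ).
Qed.

Lemma essnorm_le_mean : (essnorm p (hilbert_op g gamma) <= (C * L `^ p^-1)%:E)%E.
Proof.
apply/lee_addgt0Pr => e e0; rewrite -EFinD.
have [|K hK] := @tail_schur_near (C * L `^ p^-1 + e); first by rewrite ltrDl.
apply: essnorm_le_tail hK => //.
exact: addr_ge0 (mulr_ge0 (ltW C0) (powR_ge0 _ _)) (ltW e0).
Qed.

Lemma mean_block_density (Lam : R) : 0 < Lam -> Lam < L ->
  exists n0, forall n, (n0 <= n)%N -> Lam * harmonic_sum (d n) (d n.+1) <=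
     \sum_(d n <= k < d n.+1) modulus (g k.-1) `^ p / k%:R.
Proof.
(* L1 splits the slack: block means eventually exceed L1, and the quotient L1 / Lam is the variation
   of 1/k tolerated within a block. *)
move=> Lam0 LamL; pose L1 := (Lam + L) / 2.
have LL1 : Lam < L1 by rewrite /L1; lra.
have L1L : L1 < L by rewrite /L1; lra.
have r1 : 1 < L1 / Lam by rewrite ltr_pdivlMr// mul1r.
have r0 : 0 < L1 / Lam by exact: lt_trans r1.
have [n1 hn1] := block_ratio_le r1 ratio1.
have [n2 _ hn2] := cvgr_gt _ meanL _ L1L.
exists (maxn n1 n2) => n; rewrite geq_max => /andP[n1n n2n].
have cmp i j : (d n <= i < d n.+1)%N -> (d n <= j < d n.+1)%N ->
    (j%:R^-1 : R) <= L1 / Lam * i%:R^-1.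
  move=> /andP[di iD] /andP[dj jD].
  have i0 : 0 < i%:R :> R by rewrite ltr0n (leq_trans (dpos n)).
  have j0 : 0 < j%:R :> R by rewrite ltr0n (leq_trans (dpos n)).
  rewrite ler_pdivlMr// mulrC ler_pdivrMr//.
  apply: (@le_trans _ _ (d n.+1)%:R); first by rewrite ler_nat ltnW.
  by apply: (le_trans (hn1 n n1n)); rewrite ler_pM2l// ler_nat.
have H := block_mean_sum_ge p hd g cmp.
rewrite -(ler_pM2l r0); apply: le_trans H.
rewrite mulrA divfK ?gt_eqF// ler_wpM2r ?harmonic_sum_ge0//.
exact/ltW/(hn2 n n2n).
Qed.

Lemma essnorm_ge_mean : ((C * L `^ p^-1)%:E <= essnorm p (hilbert_op g gamma))%E.
Proof.
have L0 := mean_limit_ge0.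
have ess0 : (0%:E <= essnorm p (hilbert_op g gamma))%E.
  apply: (essnorm_ge p1) => N0; exists (fun=> 0), 0%N; split => //.
    by rewrite lpnorm0// lee_fin.
  exact: lpnorm_ge0.
have V0 : 0 <= C * L `^ p^-1 by rewrite mulr_ge0 ?powR_ge0 ?ltW.
case E : (essnorm _ _) => [v| |]; last 2 first.
- exact: leey.
- by rewrite E in ess0.
rewrite E lee_fin in ess0; rewrite lee_fin leNgt; apply/negP => vV.
(* As v is nonnegative, the assumption v < C L^(1/p) already excludes L = 0, so a positive Lam below
   L can be found. *)
pose theta := (v + C * L `^ p^-1) / 2.
have th0 : 0 <= theta by rewrite divr_ge0// addr_ge0.
have vth : v < theta by rewrite /theta; lra.
have thV : theta < C * L `^ p^-1 by rewrite /theta; lra.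
have Cp : 0 < C `^ p by rewrite powR_gt0.
have thL : theta `^ p / C `^ p < L.
  rewrite ltr_pdivrMr// mulrC -(powR_div_mulK L0 p0) -powRM ?powR_ge0 ?(ltW C0)//.
  by rewrite gt0_ltr_powR ?nnegrE.
pose Lam := (theta `^ p / C `^ p + L) / 2.
have thLam : theta `^ p / C `^ p < Lam by rewrite /Lam; lra.
have LamL : Lam < L by rewrite /Lam; lra.
have Lam0 : 0 < Lam by apply: le_lt_trans thLam; rewrite divr_ge0 ?powR_ge0.
have [n0 hn0] := mean_block_density Lam0 LamL.
have := hilbert_essnorm_ge p1 hs (block_density hd0 hd hn0) th0 Lam0.
rewrite E lee_fin leNgt vth => /(_ _)/negP; apply => //.
by rewrite mulrC -ltr_pdivrMr.
Qed.

End VanishingBlocks.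

(** * Block ratios bounded away from 1: two sequences with equal block means *)

Lemma uphalf_le m : (uphalf m <= m)%N.
Proof. by rewrite leq_uphalf_double -addnn leq_addr. Qed.

(** The second half is compared with the first by the shift k to k + s. Since s is at least (lam -
    1) a / 2 and k at most a + s, the ratio s/k is at least tau = (lam - 1)/(lam + 1), so each
    shifted term shrinks by 1 + tau. The resulting factor is less than 2. *)
Lemma half_block_gain (lam : R) (a b : nat) : 1 < lam -> (0 < a)%N -> (a <= b)%N ->
  lam * a%:R <= b%:R ->
  harmonic_sum a b <=
    (1 + (1 + (lam - 1) / (lam + 1))^-1) * harmonic_sum a (a + uphalf (b - a)).
Proof.
move=> lam1 a0 ab lamab; set s := uphalf (b - a).
have sb : (b - a <= s + s)%N by rewrite addnn -leq_uphalf_double.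
have sm : (s <= b - a)%N by exact: uphalf_le.
have asb : (a + s <= b)%N by rewrite -(subnKC ab) leq_add2l.
set tau := (lam - 1) / (lam + 1).
have lamp : 0 < lam + 1 by lra.
have tau0 : 0 < tau by rewrite divr_gt0// subr_gt0.
rewrite (harmonic_sum_cat (leq_addr s a) asb) mulrDl mul1r lerD2l.
rewrite {1}/harmonic_sum big_addn.
have bs : (b - s <= s + a)%N by rewrite leq_subLR addnA addnC -leq_subLR.
apply: (@le_trans _ _ (\sum_(a <= i < s + a) (i + s)%:R^-1)).
  rewrite [leRHS](@big_cat_nat _ _ _ (b - s)%N)//=; last first.
    by rewrite leq_subRL ?(leq_trans (leq_addl a s))// addnC.
  by rewrite lerDl sumr_ge0// => *; rewrite invr_ge0.
rewrite /harmonic_sum addnC mulr_sumr; apply: ler_sum_nat => k /andP[ak ks].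
have kpos : (0 < k)%N by exact: leq_trans ak.
rewrite -invfM lef_pV2 ?posrE ?mulr_gt0 ?addr_gt0 ?ltr0n ?addn_gt0 ?kpos//.
rewrite natrD mulrDl mul1r lerD2l /tau mulrAC ler_pdivrMr//.
have hk : k%:R <= a%:R + s%:R :> R by rewrite -natrD ler_nat ltnW.
have h2 : b%:R - a%:R <= s%:R + s%:R :> R by rewrite -natrB// -natrD ler_nat.
have : (lam - 1) * k%:R <= (lam - 1) * (a%:R + s%:R) by rewrite ler_wpM2l// subr_ge0 ltW.
lra.
Qed.

(* The mean over every block is 1, but 1/k decreases: the weighted harmonic sum
   over a long block exceeds the unweighted one by a factor bounded away from
   1. *)
Lemma half_block_weight : exists v : nat -> R, (forall k, 0 <= v k <= 2) /\
  forall n k, (d n <= k < d n.+1)%N -> v k =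
    if (k < d n + uphalf (d n.+1 - d n))%N
    then (d n.+1 - d n)%:R / (uphalf (d n.+1 - d n))%:R else 0.
Proof.
have /choice[v hv] : forall k, exists y : R, 0 <= y <= 2 /\
  forall n, (d n <= k < d n.+1)%N -> y =
    if (k < d n + uphalf (d n.+1 - d n))%N
    then (d n.+1 - d n)%:R / (uphalf (d n.+1 - d n))%:R else 0.
  move=> k; have [[n hn]|hk] := pselect (exists n, (d n <= k < d n.+1)%N); last first.
    by exists 0; rewrite lexx ler0n; split => // n hn; case: hk; exists n.
  exists (if (k < d n + uphalf (d n.+1 - d n))%N
    then (d n.+1 - d n)%:R / (uphalf (d n.+1 - d n))%:R else 0); split.
    case: ifP => _; last by rewrite lexx ler0n.
    have m0 : (0 < d n.+1 - d n)%N by rewrite subn_gt0 hd.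
    (* Rounding the half up keeps it nonempty for blocks of length 1 and keeps the weight at most
       2. *)
    have s0 : (0 < uphalf (d n.+1 - d n))%N by rewrite uphalf_gt0.
    rewrite divr_ge0//= ler_pdivrMr ?ltr0n// -natrM ler_nat mul2n.
    by rewrite -leq_uphalf_double.
  move=> n' hn'; suff -> : n = n' by [].
  have uniq i j : (d i <= k < d i.+1)%N -> (d j <= k < d j.+1)%N -> (i <= j)%N.
    move=> /andP[ik _] /andP[_ kj]; rewrite leqNgt; apply/negP => ji.
    by have := leq_ltn_trans (leq_trans (block_bound_mono hd ji) ik) kj; rewrite ltnn.
  by apply/eqP; rewrite eqn_leq (uniq n n')// (uniq n' n).
by exists v; split => [k|n k]; have [] := hv k => // _ /(_ n).
Qed.

Lemma block_mean_const1 : block_mean p d (fun=> 1) = fun=> 1.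
Proof.
apply/funext => n; rewrite /block_mean.
under eq_bigr do rewrite modulus1 powR1.
by rewrite sumr_const_nat natrB ?(ltnW (hd _))// mulVf// gt_eqF// block_size_gt0.
Qed.

Lemma essnorm_const1_le : bounded_op p (hilbert_op (fun=> 1) gamma) /\
  (essnorm p (hilbert_op (fun=> 1%R) gamma) <= C%:E)%E.
Proof.
have hW : weighted_schur p gamma (fun=> 1) (1 `^ p^-1 * C).
  by apply: weighted_schur_sup => // k; rewrite modulus1 powR1.
rewrite powR1 mul1r in hW; split; first exact: hilbert_op_bounded (ltW C0) hW.
by apply: (@essnorm_le_tail _ _ _ p1 hs 0%N); rewrite ?ltW.
Qed.

(** On the first half the weight m/s is close to 2, while that half carries at least the fraction
    1/kap of the harmonic sum, with kap < 2. *)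
Lemma long_blocks_density (lam : R) n0 v : 1 < lam ->
  (forall n, (n0 <= n)%N -> lam * (d n)%:R <= (d n.+1)%:R) ->
  (forall k, 0 <= v k <= 2) ->
  (forall n k, (d n <= k < d n.+1)%N -> v k =
    if (k < d n + uphalf (d n.+1 - d n))%N
    then (d n.+1 - d n)%:R / (uphalf (d n.+1 - d n))%:R else 0) ->
  exists2 Lam : R, 1 < Lam & exists n1, forall n, (n1 <= n)%N ->
    Lam * harmonic_sum (d n) (d n.+1) <= \sum_(d n <= k < d n.+1) v k / k%:R.
Proof.
move=> lam1 hlam v02 hv; set tau := (lam - 1) / (lam + 1).
have lamp : 0 < lam + 1 by lra.
have tau0 : 0 < tau by rewrite divr_gt0// subr_gt0.
set kap := 1 + (1 + tau)^-1.
have kap2 : kap < 2 by rewrite /kap -[2]/(1 + 1) ltrD2l invf_lt1 ?ltrDl// addr_gt0.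
have kap0 : 0 < kap by rewrite /kap addr_gt0// invr_gt0 addr_gt0.
(* Midway between 1 and the limiting gain 2 / kap; the room left absorbs the rounding in m/s. *)
exists ((1 + 2 / kap) / 2).
  have : 1 < 2 / kap by rewrite ltr_pdivlMr// mul1r.
  lra.
have LamE : (1 + 2 / kap) / 2 * kap = (kap + 2) / 2 by field; rewrite gt_eqF.
(* As 2s is at most m + 1, it suffices that m (2 - kap) is at least kap + 2, hence at least 4; and m
   is at least (lam - 1) d n. *)
pose x := 4 / (2 - kap) / (lam - 1).
exists (maxn n0 (Num.truncn x).+1) => n; rewrite geq_max => /andP[n0n xn].
have dn : x <= (d n)%:R.
  apply: (@le_trans _ _ (Num.truncn x).+1%:R); first by rewrite ltW// truncnS_gt.
  by rewrite ler_nat (leq_trans xn)// ltnW// (ltn_block_bound hd0 hd).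
have dd : (d n <= d n.+1)%N by exact/ltnW/hd.
have hg := half_block_gain lam1 (dpos n) dd (hlam n n0n).
rewrite -/tau -/kap in hg.
set m := (d n.+1 - d n)%N in hg *; set s := uphalf m in hg *.
have m0 : (0 < m)%N by rewrite subn_gt0 hd.
have s0 : (0 < s)%N by rewrite uphalf_gt0.
have s0' : 0 < s%:R :> R by rewrite ltr0n.
have sm : (s <= m)%N by exact: uphalf_le.
have s2 : (s + s <= m.+1)%N by rewrite addnn -geq_uphalf_double.
have asb : (d n + s <= d n.+1)%N by rewrite -(subnKC dd) leq_add2l.
have -> : \sum_(d n <= k < d n.+1) v k / k%:R = m%:R / s%:R * harmonic_sum (d n) (d n + s).
  rewrite (@big_cat_nat _ _ _ (d n + s)%N) ?leq_addr//= [X in _ + X]big_nat_cond.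
  rewrite [X in _ + X]big1 ?addr0; last first.
    move=> k /andP[/andP[h1 h2] _].
    by rewrite (hv n) ?h2 ?(leq_trans (leq_addr s (d n)))// -/m -/s ltnNge h1 mul0r.
  rewrite mulr_sumr; apply: eq_big_nat => k /andP[h1 h2].
  by rewrite (hv n) ?h1 ?(leq_trans h2).
have Lam0 : 0 <= (1 + 2 / kap) / 2 by rewrite divr_ge0// addr_ge0// divr_ge0// ltW.
apply: (le_trans (ler_wpM2l Lam0 hg)).
rewrite mulrA LamE ler_wpM2r ?harmonic_sum_ge0// ler_pdivlMr//.
have h1 : s%:R + s%:R <= m%:R + 1 :> R by rewrite -natrD -natS ler_nat.
have lam0 : 0 < lam - 1 by rewrite subr_gt0.
have k2 : 0 < 2 - kap by rewrite subr_gt0.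
have h2 : 4 / (2 - kap) <= m%:R.
  move: dn; rewrite /x ler_pdivrMr// => dn; apply: (le_trans dn).
  rewrite /m natrB// mulrBr mulr1 lerD2r mulrC; exact: hlam.
rewrite ler_pdivrMr// in h2.
have : 0 <= (kap + 2) * ((m%:R + 1) - (s%:R + s%:R)) by rewrite mulr_ge0 ?subr_ge0// addr_ge0// ltW.
nra.
Qed.

Lemma ratio_gt1 (l : \bar R) : ((d k.+1)%:R / (d k)%:R)%:E @[k --> \oo] --> l -> (1 < l)%E ->
  exists2 lam : R, 1 < lam & exists n0, forall n, (n0 <= n)%N ->
    lam * (d n)%:R <= (d n.+1)%:R :> R.
Proof.
have aux (lam : R) : (\forall k \near \oo, lam < (d k.+1)%:R / (d k)%:R) ->
    exists n0, forall n, (n0 <= n)%N -> lam * (d n)%:R <= (d n.+1)%:R :> R.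
  move=> [n0 _ H]; exists n0 => n nn.
  by have /ltW := H n nn; rewrite ler_pdivlMr// ltr0n.
case: l => [l| |]// cv; rewrite ?lte_fin => l1.
  move/fine_cvgP : cv => [_ cv].
  exists ((1 + l) / 2); first by rewrite ltr_pdivlMr//; lra.
  by apply: aux; apply: (cvgr_gt _ cv); rewrite ltr_pdivrMr//; lra.
exists 2; first by rewrite ltr1n.
by apply: aux; apply: filterS (cvgey_gt cv 2) => k; rewrite lte_fin.
Qed.

Lemma exists_essnorm_gt_block_mean1 (lam : R) n0 : 1 < lam ->
  (forall n, (n0 <= n)%N -> lam * (d n)%:R <= (d n.+1)%:R) ->
  exists h : nat -> R[i], [/\ bounded_op p (hilbert_op h gamma),
    block_mean p d h = (fun=> 1) & (C%:E < essnorm p (hilbert_op h gamma))%E].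
Proof.
move=> lam1 hlam; have [v [v02 hv]] := half_block_weight.
pose h k : R[i] := (v k.+1 `^ p^-1)%:C.
have v0 k : 0 <= v k by case/andP: (v02 k).
have hE k : modulus (h k) `^ p = v k.+1.
  by rewrite modulus_real ger0_norm ?powR_ge0// powR_div_mulK.
have hE' k : (0 < k)%N -> modulus (h k.-1) `^ p = v k by move=> k0; rewrite hE prednK.
exists h; split.
- have hW : weighted_schur p gamma h (2 `^ p^-1 * C).
    by apply: weighted_schur_sup => // k; rewrite hE; case/andP: (v02 k.+1).
  by apply: hilbert_op_bounded hW => //; rewrite mulr_ge0 ?powR_ge0 ?ltW.
- apply/funext => n; rewrite /block_mean.
  have dd : (d n <= d n.+1)%N by exact/ltnW/hd.
  set m := (d n.+1 - d n)%N; set s := uphalf m.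
  have m0 : (0 < m)%N by rewrite subn_gt0 hd.
  have s0 : (0 < s)%N by rewrite uphalf_gt0.
  have sm : (s <= m)%N by exact: uphalf_le.
  have asb : (d n + s <= d n.+1)%N by rewrite -(subnKC dd) leq_add2l.
  have -> : \sum_(d n <= k < d n.+1) modulus (h k.-1) `^ p = m%:R.
    rewrite (@big_cat_nat _ _ _ (d n + s)%N) ?leq_addr//= [X in _ + X]big_nat_cond.
    rewrite [X in _ + X]big1 ?addr0; last first.
      move=> k /andP[/andP[h1 h2] _].
      have dk : (d n <= k)%N by rewrite (leq_trans _ h1)// leq_addr.
      rewrite hE' ?(leq_trans (dpos n))// (hv n) ?h2 ?dk//.
      by rewrite -/m -/s ltnNge h1.
    rewrite (@eq_big_nat _ _ _ _ _ _ (fun=> m%:R / s%:R)); last first.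
      by move=> k /andP[h1 h2]; rewrite hE' ?(leq_trans (dpos n))// (hv n) ?h1 ?(leq_trans h2).
    rewrite sumr_const_nat addKn -[LHS]mulr_natr divfK// pnatr_eq0 -lt0n//.
  by rewrite -natrB// mulVf// pnatr_eq0 -lt0n.
have [Lam Lam1 [n1 hn1]] := long_blocks_density lam1 hlam v02 hv.
have Lam0 : 0 < Lam by exact: lt_trans Lam1.
(* Replacing Lam by its midpoint with 1 makes theta exceed C strictly while its p-th power stays
   below C^p Lam. *)
pose theta := C * ((1 + Lam) / 2) `^ p^-1.
have L2 : 1 < (1 + Lam) / 2 by rewrite ltr_pdivlMr//; lra.
have L2' : 0 <= (1 + Lam) / 2 by rewrite ltW// (lt_trans ltr01).
have th0 : 0 <= theta by rewrite mulr_ge0 ?powR_ge0 ?ltW.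
have Cth : C < theta.
  rewrite /theta -{1}[C]mulr1 ltr_pM2l//.
  have {1}-> : 1 = 1 `^ p^-1 :> R by rewrite powR1.
  by rewrite gt0_ltr_powR ?nnegrE ?invr_gt0.
have thp : theta `^ p < C `^ p * Lam.
  rewrite /theta powRM ?powR_ge0 ?(ltW C0)// powR_div_mulK// ltr_pM2l ?powR_gt0//.
  by rewrite ltr_pdivrMr//; lra.
apply: (@lt_le_trans _ _ theta%:E); first by rewrite lte_fin.
apply: (hilbert_essnorm_ge p1 hs _ th0 Lam0 thp).
apply: (block_density hd0 hd (n0 := n1)) => n nn; apply: (le_trans (hn1 n nn)).
rewrite le_eqVlt; apply/orP; left; apply/eqP; apply: eq_big_nat => k /andP[dk _].
by rewrite hE'// (leq_trans (dpos n)).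
Qed.

End Conclusion.

Theorem theorem2 (R : realType) (p gamma : R) (d : nat -> nat)
    (hp : 1 < p) (hgamma1 : - p^-1 < gamma) (hgamma2 : gamma < 1 - p^-1)
    (hd0 : d 0%N = 1%N) (hd : {homo d : m n / (m < n)%N}) :
  ((d k.+1)%:R / (d k)%:R @[k --> \oo] --> (1 : R) ->
     forall (g : nat -> R[i]) (L : R),
       block_mean p d g n @[n --> \oo] --> L ->
       bounded_op p (hilbert_op g gamma) /\
       essnorm p (hilbert_op g gamma)
         = (pi / sin (pi * (p^-1 + gamma)) * L `^ p^-1)%:E) /\
  (forall l : \bar R,
     ((d k.+1)%:R / (d k)%:R)%:E @[k --> \oo] --> l -> (1 < l)%E ->
     ~ exists F : (nat -> R) -> R,
         (forall u, (forall n, 0 <= u n) -> 0 <= F u) /\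
         (forall g : nat -> R[i],
            bounded_op p (hilbert_op g gamma) ->
            essnorm p (hilbert_op g gamma) = (F (block_mean p d g))%:E)).
Proof.
have hs : 0 < p^-1 + gamma < 1 by apply/andP; split; lra.
split=> [ratio1 g L meanL|l ratio l1 [F [_ hF]]].
  split; first exact: (hilbert_op_bounded_of_mean hp hs hd0 hd ratio1 meanL).
  apply/eqP; rewrite eq_le (essnorm_le_mean hp hs hd0 hd ratio1 meanL) /=.
  exact: (essnorm_ge_mean hp hs hd0 hd ratio1 meanL).
have [lam lam1 [n0 hlam]] := ratio_gt1 hd0 hd ratio l1.
have [h [hb hm hC]] := exists_essnorm_gt_block_mean1 hp hs hd0 hd lam1 hlam.
have [b1 c1] := essnorm_const1_le hp hs.
(* F receives the same argument for h and for the constant sequence 1, so both essential norms would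
   coincide. *)
move: hC; rewrite (hF h hb) hm -(block_mean_const1 p hd) -(hF _ b1).
by move=> /(le_lt_trans c1); rewrite ltxx.
Qed.
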